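(* Let $\Gamma(T)=(\gamma_n(T))$, $T\ge T_0$, be a family of sequences of real numbers satisfying assumptions (A1) and (A2) below, and let $\nu$ be a finite Borel measure which is a limiting measure for $\mathfrak{F}_\Gamma(\alpha,T)$ in $[-\Delta,\Delta]$ (as in (A2)). Then for every $\varepsilon>0$ and every $b\ge 1$, $$1+s_0(\mathbf{C}_\nu-1)-\varepsilon+o(1)<\frac{1}{\ell}\int_b^{b+\ell}\mathfrak{F}_\Gamma(\alpha,T)\,d\alpha<\mathbf{C}_\nu+\varepsilon+o(1)\quad\text{as }T\to\infty,$$ where the upper bound holds for all $\ell\ge \ell_0(\varepsilon)$ and the lower bound for all $\ell\ge\ell_0(b,\varepsilon)$, for suitable thresholds $\ell_0$ depending only on the indicated quantities.
   Context: Fourier transform: $\widehat f(\xi)=\int_{\mathbb R}e^{-2\pi i\xi x}f(x)\,dx$, and for a finite Borel measure $\mu$, $\widehat\mu(\xi)=\int e^{-2\pi i \xi x}\,d\mu(x)$. $s_0:=\min_{x\in\mathbb R}\frac{\sin x}{x}=-0.217233\ldots$. The elements of $\Gamma(T)$ need not be distinct and are counted with multiplicity. (A1): there is $\lambda>0$ with $\liminf_{T\to\infty}\frac{\#\{n:\gamma_n(T)\in(0,T]\}}{\frac{\lambda T}{2\pi}\log T}=1$. Form factor: with $w(u)=\frac{4}{4+u^2}$, for $\alpha\in\mathbb R$, $T\ge T_0$, $\mathfrak F_\Gamma(\alpha,T)=\left(\frac{\lambda T}{2\pi}\log T\right)^{-1}\sum_{\gamma,\gamma'\in(0,T]\cap\Gamma(T)}T^{i\lambda\alpha(\gamma-\gamma')}w(\gamma-\gamma')$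 (sum with multiplicity). A Borel measure $\nu$ is a limiting measure for $\mathfrak F_\Gamma$ in $[-\Delta,\Delta]$ if for every continuous $\varphi$ compactly supported in $(-\Delta,\Delta)$, $\lim_{T\to\infty}\int\varphi(\alpha)\mathfrak F_\Gamma(\alpha,T)\,d\alpha=\int\varphi\,d\nu$. (A2): there exist $\Delta>0$ and a finite Borel measure $\nu$ which is a limiting measure for $\mathfrak F_\Gamma$ in $[-\Delta,\Delta]$. $\mathcal A_\Delta$ is the class of continuous even functions $g:\mathbb R\to\mathbb R$ with $g,\widehat g\in L^1(\mathbb R)$, $\widehat g(\alpha)\le 0$ for $|\alpha|>\Delta$, and $g\ge 0$ on $\mathbb R$. For $\nu$ on $[-\Delta,\Delta]$, $\Phi_\nu(g)=\int_{-\Delta}^{\Delta}\widehat g(\alpha)\,d\nu(\alpha)$ and $\mathbf C_\nu:=\inf_{g\in\mathcal A_\Delta,\,g(0)>0}\Phi_\nu(g)/g(0)$.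
   Formalization: In Φ_ν, and so in C_ν, the integral of ĝ against ν is taken over the open interval (-Δ,Δ); with the endpoints included, point masses of ν at ±Δ, which the limiting-measure condition does not restrict, would make the claim false. *)

(* Defs.v *)
From HB Require Import structures.
From mathcomp Require Import all_boot all_order all_algebra finmap.
From mathcomp Require Import all_classical all_reals all_analysis.
From mathcomp.real_closed Require Import complex.

Set Implicit Arguments.
Unset Strict Implicit.
Unset Printing Implicit Defensive.

Import Order.TTheory GRing.Theory Num.Theory.
Import numFieldNormedType.Exports.

Local Open Scope classical_set_scope.
Local Open Scope ring_scope.
Local Open Scope complex_scope.

Section defs.
Variable R : realType.

Local Notation mu := (@lebesgue_measure R).

Definition expi (t : R) : R[i] := cos t +i* sin t.

Definition Cintegrable (f : R -> R[i]) : Prop :=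
  mu.-integrable setT (EFin \o (fun x => complex.Re (f x))) /\
  mu.-integrable setT (EFin \o (fun x => complex.Im (f x))).

Definition Cintegral (f : R -> R[i]) : R[i] :=
  (\int[mu]_x complex.Re (f x)) +i* (\int[mu]_x complex.Im (f x)).

Definition fourier (f : R -> R) (xi : R) : R[i] :=
  Cintegral (fun x => expi (- (2 * pi * xi * x)) * (f x)%:C).

Definition sinc (x : R) : R := if x == 0 then 1 else sin x / x.

(* The infimum is attained: sinc is continuous, takes negative values and
   tends to 0 at infinity. *)
Definition s0 : R := inf (range sinc).

(* gamma T n is the n-th term of the sequence Gamma(T); indexing by n accounts
   for multiplicity. Finite sequences are covered by padding with terms outside
   (0, T]. *)
Implicit Types (gamma : R -> nat -> R) (lambda Delta alpha T : R).

Definition indices gamma T : set nat := [set n | 0 < gamma T n <= T].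

Definition normalization lambda T : R := lambda * T / (2 * pi) * ln T.

Definition counting_asymptotics gamma lambda : Prop :=
  limf_einf
    (fun T => ((#|` fset_set (indices gamma T)|%fset)%:R
               / normalization lambda T)%:E) (pinfty_nbhs R) = 1%:E.

Definition weight (u : R) : R := 4 / (4 + u ^+ 2).

(* T ^ (i x) = exp (i x log T) *)
Definition form_factorC gamma lambda alpha T : R[i] :=
  (normalization lambda T)^-1%:C *
  \sum_(n \in indices gamma T) \sum_(m \in indices gamma T)
     expi (lambda * alpha * (gamma T n - gamma T m) * ln T)
     * (weight (gamma T n - gamma T m))%:C.

(* The double sum is real; see form_factorC_real. *)
Definition form_factor gamma lambda alpha T : R :=
  complex.Re (form_factorC gamma lambda alpha T).

Definition support_in (phi : R -> R) (A : set R) : Prop :=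
  compact (closure [set x | phi x != 0]) /\
  closure [set x | phi x != 0] `<=` A.

Definition limiting_measure gamma lambda Delta
    (nu : {measure set (measurableTypeR R) -> \bar R}) : Prop :=
  forall phi : R -> R, continuous phi -> support_in phi `]- Delta, Delta[ ->
    (\int[mu]_alpha (phi alpha * form_factor gamma lambda alpha T))
      @[T --> +oo] --> \int[nu]_alpha phi alpha.

(* In R[i], z <= 0 means that z is real and nonpositive. *)
Definition admissible Delta : set (R -> R) :=
  [set g : R -> R | [/\ continuous g, (forall x : R, g (- x) = g x)
             & mu.-integrable setT (EFin \o g)] /\
           [/\ Cintegrable (fourier g),
               (forall alpha, Delta < `|alpha| -> fourier g alpha <= 0)
             & (forall x : R, 0 <= g x)]].

(* The endpoints are excluded: being a limiting measure in [-Delta, Delta]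
   leaves the masses of nu at -Delta and Delta arbitrary, so they must not enter
   the functional. For nu without atoms there, this is the integral over
   [-Delta, Delta]. *)
Definition Phi Delta (nu : {measure set (measurableTypeR R) -> \bar R})
    (g : R -> R) : R :=
  \int[nu]_(alpha in `]- Delta, Delta[) complex.Re (fourier g alpha).

Definition Cconst Delta (nu : {measure set (measurableTypeR R) -> \bar R}) : R :=
  inf [set Phi Delta nu g / g 0 |
        g in [set g : R -> R | admissible Delta g /\ 0 < g 0]].

Definition form_factor_mean gamma lambda (b l : R) T : R :=
  l^-1 * \int[mu]_(alpha in `[b, b + l]) form_factor gamma lambda alpha T.

Lemma form_factorC_real gamma lambda alpha T :
  finite_set (indices gamma T) ->
  form_factorC gamma lambda alpha T = (form_factor gamma lambda alpha T)%:C.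
Proof.
move=> finA; rewrite /form_factor /form_factorC.
set S := (X in _ * X).
suff S0 : complex.Im S = 0.
  by case: S S0 => a b /= ->; rewrite /real_complex_def; simpc.
pose h n m := weight (gamma T n - gamma T m)
  * sin (lambda * alpha * (gamma T n - gamma T m) * ln T).
have -> : complex.Im S = \sum_(n \in indices gamma T) \sum_(m \in indices gamma T) h n m.
  rewrite /S !fsbig_finite//= raddf_sum; apply: eq_bigr => n _ /=.
  rewrite !fsbig_finite//= raddf_sum; apply: eq_bigr => m _ /=.
  by rewrite /h /expi /=; simpc; rewrite mulrC.
have hN n m : h m n = - h n m.
  rewrite /h -(opprB (gamma T n)) /weight sqrrN.
  by rewrite mulrN mulNr sinN mulrN.
set U := (X in X = 0).
have : U = - U.
  rewrite {1}/U exchange_fsbig// /U !fsbig_finite//= -sumrN.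
  apply: eq_bigr => n _; rewrite !fsbig_finite//= -sumrN.
  by apply: eq_bigr => m _.
by move/eqP; rewrite -addr_eq0 -mulr2n mulrn_eq0/= => /eqP.
Qed.

End defs.

(* Main.v *)
Require Import Defs.
From HB Require Import structures.
From mathcomp Require Import all_boot all_order all_algebra.
From mathcomp Require Import all_classical all_reals all_analysis.
From mathcomp Require Import measurable_realfun ring lra.
From mathcomp.real_closed Require Import complex.

Import Order.TTheory GRing.Theory Num.Theory.
Import numFieldNormedType.Exports.

Local Open Scope classical_set_scope.
Local Open Scope ring_scope.

(** For [g] admissible write [G] for its Fourier transform and [F] for the form
factor at height [T]. By Fourier inversion, the integral of [G F] is the pair sum
of [g] over the scaled differences of ordinates, and it is at most
[Phi g + o(1)] since [F >= 0] and [G <= 0] outside [-Delta, Delta].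

Replacing [F] by its average over a translated interval of length [L] centred
at [m] multiplies the summand of frequency [c] by [sinc (c L / 2) cos (c m)].
The bound [|sinc| <= 1] then compares averages of [F] with [Phi g / g 0] from
above. For [m = 0], the bound [sinc >= s0] together with [sinc 0 = 1] on the
diagonal, whose size is controlled by the counting asymptotics, gives the lower
bound.

Testing [F] against a triangle, whose transform is nonnegative, bounds the mass
of [F] on unit intervals uniformly in their position. Hence the convolution of
[G] with an interval may be replaced by [g 0] times that interval, with an error
that is negligible with respect to [L]. *)

(** * Integration on the line *)

(** The two thresholds differ because [sinc (c L / 2) * cos (c m)] is bounded below by [s0] only
    when m = 0: for another centre the cosine can reverse the sign of a [sinc] close to 1. The lower
    bound is therefore proved on [-(b + l), b + l], halved because F is even, and the part over
    [0, b] is removed at a cost that depends on b. The upper bound uses absolute values only, so any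
    centre is allowed and its threshold does not see b.

    The other obstacle is at the endpoints of [-Delta, Delta]: the limiting measure may be tested
    only against continuous functions supported inside the open interval, whereas G need not vanish
    at Delta. A cutoff of G is tested instead. What it loses is controlled from one side only:
    continuity and the sign condition make the positive part of G small near the endpoints, and the
    negative part helps.

    The infimum defining [Cconst] need not be attained, so a near-minimiser g is fixed before l and
    T. As g is even, every transform is a real cosine integral, and as the pair sums are finite,
    they commute with integrals freely. *)

Section continuity.
Context {R : realType} {T : topologicalType}.
Implicit Types f g : T -> R.

Lemma cts_cst (c : R) : continuous (fun _ : T => c).
Proof. by move=> x; exact: cvg_cst. Qed.

Lemma cts_add f g : continuous f -> continuous g ->
  continuous (fun x => f x + g x).
Proof. by move=> cf cg x; apply: cvgD; [exact: cf|exact: cg]. Qed.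

Lemma cts_opp f : continuous f -> continuous (fun x => - f x).
Proof. by move=> cf x; apply: cvgN; exact: cf. Qed.

Lemma cts_mul f g : continuous f -> continuous g ->
  continuous (fun x => f x * g x).
Proof. by move=> cf cg x; apply: cvgM; [exact: cf|exact: cg]. Qed.

Lemma cts_exp f n : continuous f -> continuous (fun x => f x ^+ n).
Proof.
move=> cf; elim: n => [|n ih]; first exact: cts_cst.
by under eq_fun do rewrite exprS; exact: cts_mul.
Qed.

Lemma cts_inv f : (forall x, f x != 0) -> continuous f ->
  continuous (fun x => (f x)^-1).
Proof. by move=> f0 cf x; apply: cvgV; [exact: f0|exact: cf]. Qed.

Lemma cts_norm f : continuous f -> continuous (fun x => `|f x|).
Proof. by move=> cf x; apply: cvg_norm; exact: cf. Qed.

Lemma cts_max f g : continuous f -> continuous g ->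
  continuous (fun x => Num.max (f x) (g x)).
Proof.
move=> cf cg; under eq_fun do rewrite maxr_absE.
apply: cts_mul; last exact: cts_cst.
by apply: cts_add; [exact: cts_add|apply/cts_norm/cts_add => //; exact: cts_opp].
Qed.

Lemma cts_min f g : continuous f -> continuous g ->
  continuous (fun x => Num.min (f x) (g x)).
Proof.
move=> cf cg; under eq_fun do rewrite minr_absE.
apply: cts_mul; last exact: cts_cst.
apply: cts_add; first exact: cts_add.
by apply/cts_opp/cts_norm/cts_add => //; exact: cts_opp.
Qed.

Lemma cts_comp (h : R -> R) f : continuous h -> continuous f ->
  continuous (fun x => h (f x)).
Proof. by move=> ch cf x; exact: (continuous_comp (cf x) (ch (f x))). Qed.

Lemma cts_cos f : continuous f -> continuous (fun x => cos (f x)).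
Proof. by apply: cts_comp; exact: continuous_cos. Qed.

Lemma cts_sin f : continuous f -> continuous (fun x => sin (f x)).
Proof. by apply: cts_comp; exact: continuous_sin. Qed.

Lemma cts_expR f : continuous f -> continuous (fun x => expR (f x)).
Proof. by apply: cts_comp; exact: continuous_expR. Qed.

End continuity.

Lemma cts_id {R : realType} : continuous (fun x : R => x).
Proof. by move=> x; exact: cvg_id. Qed.

Ltac cts := lazymatch goal with
  | |- continuous (fun _ => ?c) => apply: cts_cst
  | |- continuous (fun x => x) => apply: cts_id
  | |- continuous (fun x => cos (@?f x)) => apply: (@cts_cos _ _ f); cts
  | |- continuous (fun x => sin (@?f x)) => apply: (@cts_sin _ _ f); cts
  | |- continuous (fun x => expR (@?f x)) => apply: (@cts_expR _ _ f); cts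
  | |- continuous (fun x => `|@?f x|) => apply: (@cts_norm _ _ f); cts
  | |- continuous (fun x => Num.max (@?f x) (@?g x)) =>
      apply: (@cts_max _ _ f g); cts
  | |- continuous (fun x => Num.min (@?f x) (@?g x)) =>
      apply: (@cts_min _ _ f g); cts
  | |- continuous (fun x => - @?f x) => apply: (@cts_opp _ _ f); cts
  | |- continuous (fun x => @?f x + @?g x) => apply: (@cts_add _ _ f g); cts
  | |- continuous (fun x => @?f x * @?g x) => apply: (@cts_mul _ _ f g); cts
  | |- continuous (fun x => @?f x ^+ ?n) => apply: (@cts_exp _ _ f n); cts
  | |- continuous (fun x => (@?f x)^-1) => apply: (@cts_inv _ _ f); [|cts]
  | |- _ => try assumption
  end.

Section real_integral.
Context {R : realType}.
Local Notation mu := (@lebesgue_measure R).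
Implicit Types f g h : R -> R.

Lemma integrable_mul_bounded g h (M : R) : mu.-integrable setT (EFin \o g) ->
  measurable_fun setT h -> (forall x, `|h x| <= M) ->
  mu.-integrable setT (EFin \o (fun x => g x * h x)).
Proof.
move=> ig mh hM.
have M0 : 0 <= M by rewrite (le_trans _ (hM 0)).
have mg : measurable_fun setT g by apply/measurable_EFinP; exact: measurable_int ig.
apply: (@le_integrable _ _ _ mu setT measurableT _ (fun x => M%:E * (g x)%:E)%E).
- by apply/measurable_EFinP; exact: measurable_funM.
- move=> x _ /=; rewrite lee_fin !normrM mulrC (ger0_norm M0).
  by rewrite ler_wpM2r.
- exact: integrableZl.
Qed.

Lemma integrable_mul_continuous g h (M : R) :
  mu.-integrable setT (EFin \o g) ->
  continuous h -> (forall x, `|h x| <= M) ->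
  mu.-integrable setT (EFin \o (fun x => g x * h x)).
Proof.
by move=> ig ch; apply: integrable_mul_bounded => //; exact: continuous_measurable_fun.
Qed.

Lemma integrable_le f g : continuous f -> (forall x, `|f x| <= g x) ->
  mu.-integrable setT (EFin \o g) -> mu.-integrable setT (EFin \o f).
Proof.
move=> cf fg; apply: le_integrable => //.
  by apply/measurable_EFinP; exact: continuous_measurable_fun.
by move=> x _ /=; rewrite lee_fin (le_trans (fg x)) // ler_norm.
Qed.

(** Substitution is applied on half-lines: splitting at 0 writes each side as a sum of the same two
    integrals over [0, +oo[, and reflection exchanges them. *)
Lemma ge0_integral_oppr f : continuous f -> (forall x, 0 <= f x) ->
  (\int[mu]_x (f (- x))%:E = \int[mu]_x (f x)%:E)%E.
Proof.
have split g : continuous g -> (forall x, 0 <= g x) ->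
    (\int[mu]_x (g x)%:E = \int[mu]_(x in `[0%R, +oo[) (g x)%:E
                          + \int[mu]_(x in `[0%R, +oo[) (g (- x))%:E)%E.
  move=> cg g0.
  have mg : measurable_fun [set: R] (EFin \o g).
    by apply/measurable_EFinP; exact: continuous_measurable_fun.
  rewrite -(setUv `[0%R, +oo[%classic) ge0_integral_setU//=; last 4 first.
    exact: measurableC.
    by rewrite setUv.
    by move=> x _; rewrite lee_fin.
    exact/disj_setPCl.
  congr +%E.
  rewrite setCitvr integral_itv_bndo_bndc; last exact: measurable_funTS.
  rewrite -{1}oppr0 ge0_integration_by_substitutionNy//.
  exact: continuous_subspaceT.
move=> cf f0; rewrite split//; last first.
  exact: (cts_comp f _ cf (cts_opp _ cts_id)).
rewrite [RHS]split// addeC; congr (_ + _)%E.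
by under eq_integral do rewrite opprK.
Qed.

Lemma ge0_integral_shift f (t : R) : continuous f -> (forall x, 0 <= f x) ->
  (\int[mu]_x (f (x - t))%:E = \int[mu]_x (f x)%:E)%E.
Proof.
move=> cf f0.
have d1 : derive1 (fun x : R => x - t) = cst 1.
  apply/funext => x; rewrite derive1E.
  by rewrite deriveD// derive_id derive_cst addr0.
rewrite [RHS](@increasing_ge0_integration_by_substitutionT _ (fun x => x - t))//.
- by apply: eq_integral => x _; rewrite !fctE d1 mulr1.
- by move=> x y xy; rewrite ltrD2r.
- by rewrite d1; exact: cts_cst.
- by rewrite d1; exact: is_cvg_cst.
- by rewrite d1; exact: is_cvg_cst.
- exact: cvg_addrr_Ny.
- exact: cvg_addrr.
Qed.

(** A signed f is the difference of the nonnegative functions |f| + f and |f|, to which the previous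
    result applies. *)
Lemma Rintegral_oppr f : continuous f -> mu.-integrable setT (EFin \o f) ->
  \int[mu]_x f (- x) = \int[mu]_x f x.
Proof.
move=> cf intf.
have cfN : continuous (fun x => f (- x)).
  exact: (cts_comp f _ cf (cts_opp _ cts_id)).
have finE g : (forall x, 0 <= g x) -> (\int[mu]_x (g x)%:E < +oo)%E ->
    (\int[mu]_x `|(g x)%:E| < +oo)%E.
  by move=> g0; under [in X in _ -> X]eq_integral do rewrite gee0_abs ?lee_fin//.
have intabs : mu.-integrable setT (EFin \o (fun x => `|f x|)) by exact: integrable_norm.
have intabsN : mu.-integrable setT (EFin \o (fun x => `|f (- x)|)).
  apply/integrableP; split.
    by apply/measurable_EFinP; apply: continuous_measurable_fun; cts.
  apply: finE => //.
  rewrite (@ge0_integral_oppr (fun x => `|f x|))//; last by cts.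
  exact: integrable_lty intabs.
have intfN : mu.-integrable setT (EFin \o (fun x => f (- x))).
  exact: integrable_le intabsN.
have key g : continuous g -> (forall x, 0 <= g x) ->
    \int[mu]_x g (- x) = \int[mu]_x g x.
  by move=> cg g0; congr fine; exact: ge0_integral_oppr.
have : \int[mu]_x (`|f (- x)| + f (- x)) = \int[mu]_x (`|f x| + f x).
  apply: (key (fun x => `|f x| + f x)); first by cts.
  by move=> x; have := ler_norm (- f x); rewrite normrN; lra.
rewrite !RintegralD// (key (fun x => `|f x|))//; last by cts.
exact: addrI.
Qed.

Lemma Rintegral_odd f : continuous f -> mu.-integrable setT (EFin \o f) ->
  (forall x, f (- x) = - f x) -> \int[mu]_x f x = 0.
Proof.
move=> cf intf fN; have := Rintegral_oppr _ cf intf.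
under eq_Rintegral do rewrite fN -mulN1r.
rewrite RintegralZl//; lra.
Qed.

(** H is separate from f because f may contain |x|: F is a primitive, on the whole line, of a smooth
    H that agrees with f only for x >= 0, and evenness does the rest. *)
Lemma even_ge0_FTC f (F H : R -> R) (l : R) :
  continuous f -> (forall x, 0 <= f x) -> (forall x, f (- x) = f x) ->
  (forall x : R, is_derive x (1 : R) F (H x)) -> (forall x : R, 0 <= x -> H x = f x) ->
  F x @[x --> +oo] --> l ->
  (\int[mu]_x (f x)%:E = (2 * (l - F 0))%:E)%E.
Proof.
move=> cf f0 fN dF HF Fl.
rewrite ge0_symfun_integralT//; last by move=> x; rewrite /= fN.
have cF : F x @[x --> 0^'+] --> F 0.
  apply: cvg_at_right_filter; apply: differentiable_continuous.
  by apply/derivable1_diffP; case: (dF 0).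
have dF1 (x : R) : 0 < x -> derivable F x 1 by case: (dF x).
have cf0 : {within `[0, +oo[, continuous f} by exact: continuous_subspaceT.
have F'f : {in `]0, +oo[, derive1 F =1 f}.
  move=> x; rewrite in_itv/= andbT => x0.
  by rewrite derive1E (@derive_val _ _ _ _ _ _ _ (dF x)) HF// ltW.
by rewrite -set_itvcy (ge0_continuous_FTC2y _ cf0 Fl dF1 cF F'f).
Qed.

Lemma ge0_integrable f (v : R) : continuous f -> (forall x, 0 <= f x) ->
  (\int[mu]_x (f x)%:E = v%:E)%E -> mu.-integrable setT (EFin \o f).
Proof.
move=> cf f0 e; apply/integrableP; split.
  by apply/measurable_EFinP; exact: continuous_measurable_fun.
by under eq_integral do rewrite /= ger0_norm//; rewrite e ltry.
Qed.

End real_integral.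

(** * The Poisson kernel *)

Section derivation.
Context {R : realType}.
Implicit Types (f g : R -> R) (x df dg : R).

(* Unlike [is_derive], this is not a class: the premises of the rules below are
   then not submitted to instance resolution. *)
Definition has_der f x df : Prop := is_derive x (1 : R) f df.

Lemma der_cst (c x : R) : has_der (fun _ : R => c) x 0.
Proof. exact: is_derive_cst. Qed.

Lemma der_id x : has_der (fun y : R => y) x 1.
Proof. exact: is_derive_id. Qed.

Lemma der_add f g x df dg : has_der f x df -> has_der g x dg ->
  has_der (fun y => f y + g y) x (df + dg).
Proof. by rewrite /has_der => ? ?; exact: is_deriveD. Qed.

Lemma der_opp f x df : has_der f x df -> has_der (fun y => - f y) x (- df).
Proof. by rewrite /has_der => ?; exact: is_deriveN. Qed.

Lemma der_mul f g x df dg : has_der f x df -> has_der g x dg ->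
  has_der (fun y => f y * g y) x (f x * dg + g x * df).
Proof. by rewrite /has_der => ? ?; exact: is_deriveM. Qed.

Lemma der_comp (h : R -> R) f x df dh : has_der h (f x) dh ->
  has_der f x df -> has_der (fun y => h (f y)) x (dh * df).
Proof. by rewrite /has_der => ? ?; exact: is_derive1_comp. Qed.

Lemma der_cos f x df : has_der f x df ->
  has_der (fun y => cos (f y)) x (- sin (f x) * df).
Proof. by apply: der_comp; exact: is_derive_cos. Qed.

Lemma der_sin f x df : has_der f x df ->
  has_der (fun y => sin (f y)) x (cos (f x) * df).
Proof. by apply: der_comp; exact: is_derive_sin. Qed.

Lemma der_expR f x df : has_der f x df ->
  has_der (fun y => expR (f y)) x (expR (f x) * df).
Proof. by apply: der_comp; exact: is_derive_expR. Qed.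

Lemma der_atan f x df : has_der f x df ->
  has_der (fun y => atan (f y)) x ((1 + f x ^+ 2)^-1 * df).
Proof. by apply: der_comp; exact: is_derive1_atan. Qed.

Lemma der_eq f x df dg : has_der f x df -> df = dg -> has_der f x dg.
Proof. by move=> + <-. Qed.

End derivation.

Ltac der := repeat first
  [ eassumption | apply: der_cst | apply: der_id | apply: der_opp
  | apply: der_add | apply: der_cos | apply: der_sin | apply: der_expR
  | apply: der_atan | apply: der_mul ].

Lemma Rintegral_FTC {R : realType} (f F : R -> R) (a b : R) :
  a <= b -> continuous f -> (forall t, has_der F t (f t)) ->
  \int[@lebesgue_measure R]_(t in `[a, b]) f t = F b - F a.
Proof.
move=> + cf dF; rewrite le_eqVlt => /predU1P[<-|ab].
  by rewrite set_itv1 Rintegral_set1 subrr.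
have cF t : {for t, continuous F}.
  by apply: differentiable_continuous; apply/derivable1_diffP; case: (dF t).
rewrite /Rintegral (@continuous_FTC2 _ f F)//.
- exact: continuous_subspaceT.
- split.
  + by move=> t _; case: (dF t).
  + by apply: cvg_at_right_filter; exact: cF.
  + by apply: cvg_at_left_filter; exact: cF.
- by move=> t _; rewrite derive1E; case: (dF t).
Qed.

Section poisson.
Context {R : realType}.
Local Notation mu := (@lebesgue_measure R).

(** Adding 1 to the cosine keeps the integrand nonnegative, so that its integral can be computed
    before integrability is known. *)
Let expcos (a u y : R) := expR (- (a * `|y|)) * (1 + cos (u * y)).

Let integral_expcos (a u : R) : 0 < a ->
  (\int[mu]_y (expcos a u y)%:E = (2 * (a^-1 + a / (a ^+ 2 + u ^+ 2)))%:E)%E.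
Proof.
move=> a0.
have au : a ^+ 2 + u ^+ 2 != 0 by rewrite gt_eqF// ltr_pwDl ?exprn_gt0 ?sqr_ge0.
pose F (y : R) := expR (- (a * y)) *
  (- a^-1 + (a ^+ 2 + u ^+ 2)^-1 * (u * sin (u * y) - a * cos (u * y))).
pose H (y : R) := expR (- (a * y)) * (1 + cos (u * y)).
have dF y : has_der F y (H y).
  rewrite /F; apply: der_eq; first by der.
  by rewrite /H; field; rewrite au gt_eqF.
rewrite (@even_ge0_FTC _ (expcos a u) F H 0 _ _ _ dF).
- congr (_%:E); rewrite /F !mulr0 oppr0 expR0 sin0 cos0.
  by field; rewrite au gt_eqF.
- by rewrite /expcos; cts.
- move=> y; apply: mulr_ge0; first exact: expR_ge0.
  by have := cos_geN1 (u * y); lra.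
- by move=> y; rewrite /expcos normrN mulrN cosN.
- by move=> y y0; rewrite /H /expcos ger0_norm.
- pose M := a^-1 + (a ^+ 2 + u ^+ 2)^-1 * (`|u| + a).
  have FM y : `|F y| <= M * expR (- (a * y)).
    rewrite /F normrM [`|expR _|]ger0_norm ?expR_ge0// mulrC.
    apply: ler_wpM2r; first exact: expR_ge0.
    have ai : 0 < a^-1 by rewrite invr_gt0.
    have qi : 0 < (a ^+ 2 + u ^+ 2)^-1.
      by rewrite invr_gt0 ltr_pwDl ?exprn_gt0 ?sqr_ge0.
    rewrite (le_trans (ler_normD _ _))// normrN (gtr0_norm ai) lerD2l.
    rewrite normrM (gtr0_norm qi) ler_wpM2l// ?(ltW qi)//.
    rewrite (le_trans (ler_normB _ _))// !normrM lerD//.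
      by rewrite ler_piMr// sin_max.
    by rewrite (gtr0_norm a0) ler_piMr ?(ltW a0)// cos_max.
  have eM : M * expR (- (a * y)) @[y --> +oo] --> 0.
    rewrite -[0](mulr0 M); apply: cvgM; first exact: cvg_cst.
    apply: (@cvg_comp _ _ _ (fun y : R => a * y) (fun y : R => expR (- y)) _ +oo).
      exact: gt0_cvgMry.
    exact: cvgr_expR.
  apply/norm_cvg0P; apply: (@squeeze_cvgr _ _ _ _ (cst 0)) eM.
    by near=> y; rewrite normr_ge0 /= FM.
  exact: cvg_cst.
Unshelve. all: by end_near. Qed.

Let integrable_expcos (a u : R) : 0 < a ->
  mu.-integrable setT (EFin \o expcos a u).
Proof.
move=> a0; apply: ge0_integrable (integral_expcos a u a0).
  by rewrite /expcos; cts.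
move=> y; apply: mulr_ge0; first exact: expR_ge0.
by have := cos_geN1 (u * y); lra.
Qed.

Lemma integrable_exp_norm (a : R) : 0 < a ->
  mu.-integrable setT (EFin \o (fun y => expR (- (a * `|y|)))).
Proof.
move=> a0; apply: integrable_le (integrable_expcos a 0 a0); first by cts.
move=> y; rewrite ger0_norm ?expR_ge0// /expcos mul0r cos0.
by have := expR_ge0 (- (a * `|y|)); lra.
Qed.

Lemma integrable_exp_norm_cos (a u : R) : 0 < a ->
  mu.-integrable setT (EFin \o (fun y => expR (- (a * `|y|)) * cos (u * y))).
Proof.
move=> a0; apply: (@integrable_mul_continuous _ _ _ 1) => //.
- exact: integrable_exp_norm.
- by cts.
- by move=> x; exact: cos_max.
Qed.

Lemma integral_exp_norm_cos (a u : R) : 0 < a ->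
  \int[mu]_y (expR (- (a * `|y|)) * cos (u * y)) = 2 * a / (a ^+ 2 + u ^+ 2).
Proof.
move=> a0.
have au : a ^+ 2 + u ^+ 2 != 0 by rewrite gt_eqF// ltr_pwDl ?exprn_gt0 ?sqr_ge0.
(* At v = 0 both integrals on the left coincide, which gives the integral of the exponential alone;
   subtracting it from the case v = u leaves the cosine integral. *)
have D v : \int[mu]_y expR (- (a * `|y|)) +
    \int[mu]_y (expR (- (a * `|y|)) * cos (v * y)) =
    2 * (a^-1 + a / (a ^+ 2 + v ^+ 2)).
  rewrite -RintegralD//; last 2 first.
    exact: integrable_exp_norm.
    exact: integrable_exp_norm_cos.
  transitivity (\int[mu]_y expcos a v y).
    by apply: eq_Rintegral => y _; rewrite /expcos mulrDr mulr1.
  by rewrite /Rintegral integral_expcos.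
have := D u; have := D 0.
under [X in _ + X]eq_Rintegral do rewrite mul0r cos0 mulr1.
rewrite expr0n addr0.
have -> : a / a ^+ 2 = a^-1 by field; rewrite gt_eqF.
move=> e1 e2.
have : \int[mu]_y (expR (- (a * `|y|)) * cos (u * y)) =
  2 * (a / (a ^+ 2 + u ^+ 2)) by lra.
by rewrite mulrA.
Qed.

(** The Fourier transform of exp (-a|y|), that is, the Poisson kernel of the half-plane at height a
    / (2 pi). *)
Definition poisson (a s : R) : R := 2 * a / (a ^+ 2 + (2 * pi * s) ^+ 2).

Lemma poisson_den_gt0 (a s : R) : 0 < a -> 0 < a ^+ 2 + (2 * pi * s) ^+ 2.
Proof. by move=> a0; rewrite ltr_pwDl ?exprn_gt0 ?sqr_ge0. Qed.

Lemma poisson_gt0 (a s : R) : 0 < a -> 0 < poisson a s.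
Proof. by move=> a0; rewrite divr_gt0 ?poisson_den_gt0// mulr_gt0. Qed.

Lemma poissonN (a s : R) : poisson a (- s) = poisson a s.
Proof. by rewrite /poisson mulrN sqrrN. Qed.

Lemma poisson_continuous (a : R) : 0 < a -> continuous (poisson a).
Proof.
move=> a0; rewrite /poisson; cts.
by move=> s; rewrite gt_eqF// poisson_den_gt0.
Qed.

Let integral_poisson (a : R) : 0 < a -> (\int[mu]_s (poisson a s)%:E = 1)%E.
Proof.
move=> a0; have p0 : pi != 0 :> R by rewrite gt_eqF// pi_gt0.
pose F (s : R) := pi^-1 * atan (2 * pi / a * s).
have dF s : has_der F s (poisson a s).
  rewrite /F; apply: der_eq; first by der.
  have := poisson_den_gt0 _ s a0; move: p0; rewrite /poisson.
  move: (pi : R) => p p0 d0; field.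
  by rewrite p0 !gt_eqF.
rewrite (@even_ge0_FTC _ (poisson a) F (poisson a) 2^-1 _ _ _ dF)//.
- rewrite /F mulr0 atan0 mulr0 subr0 divff//.
- exact: poisson_continuous.
- by move=> s; rewrite ltW// poisson_gt0.
- by move=> s; rewrite poissonN.
- rewrite (_ : 2^-1 = pi^-1 * (pi / 2)); last by rewrite mulKf.
  apply: cvgM; first exact: cvg_cst.
  apply: (@cvg_comp _ _ _ (fun s : R => 2 * pi / a * s) (@atan R) _ +oo).
    by apply: gt0_cvgMry => //; rewrite divr_gt0// mulr_gt0// pi_gt0.
  exact: cvgy_atan.
Qed.

Lemma integrable_poisson_shift (a t : R) : 0 < a ->
  mu.-integrable setT (EFin \o (fun x => poisson a (x - t))).
Proof.
move=> a0; apply: (@ge0_integrable _ _ 1).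
- apply: (@cts_comp _ _ (poisson a) (fun x => x - t)); last by cts.
  exact: poisson_continuous.
- by move=> x; rewrite ltW// poisson_gt0.
- rewrite ge0_integral_shift ?integral_poisson//; first exact: poisson_continuous.
  by move=> s; rewrite ltW// poisson_gt0.
Qed.

Lemma integrable_poisson (a : R) : 0 < a ->
  mu.-integrable setT (EFin \o poisson a).
Proof.
move=> a0; have := integrable_poisson_shift a 0 a0.
by under [X in _.-integrable _ (_ \o X)]eq_fun do rewrite subr0.
Qed.

Lemma integral_poisson_shift (a t : R) : 0 < a ->
  \int[mu]_x poisson a (x - t) = 1.
Proof.
move=> a0; rewrite /Rintegral ge0_integral_shift ?integral_poisson//.
  exact: poisson_continuous.
by move=> s; rewrite ltW// poisson_gt0.
Qed.

End poisson.

(** * Fourier inversion *)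

Section cosine_transform.
Context {R : realType}.
Local Notation mu := (@lebesgue_measure R).
Implicit Types f g h : R -> R.

(** The real part of the Fourier transform of g, and all of it when g is even; working with it keeps
    inversion within the reals. *)
Definition cosft g (xi : R) : R := \int[mu]_x (g x * cos (2 * pi * xi * x)).

Lemma integrable_mul_cos g (c : R) : mu.-integrable setT (EFin \o g) ->
  mu.-integrable setT (EFin \o (fun x => g x * cos (c * x))).
Proof.
move=> ig; apply: (integrable_mul_continuous _ _ 1 ig); first by cts.
by move=> x; exact: cos_max.
Qed.

Lemma integrable_mul_sin g (c : R) : mu.-integrable setT (EFin \o g) ->
  mu.-integrable setT (EFin \o (fun x => g x * sin (c * x))).
Proof.
move=> ig; apply: (integrable_mul_continuous _ _ 1 ig); first by cts.
by move=> x; exact: sin_max.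
Qed.

Lemma cosftN g xi : cosft g (- xi) = cosft g xi.
Proof.
by apply: eq_Rintegral => x _; rewrite mulrN mulNr cosN.
Qed.

Lemma cosft_continuous g : mu.-integrable setT (EFin \o g) ->
  continuous (cosft g).
Proof.
move=> ig xi.
have := @continuity_under_integral R _ _ mu
  (fun xi x => g x * cos (2 * pi * xi * x)) setT measurableT (xi - 1) (xi + 1)
  _ _ (fun x => `|g x|) _ _ xi.
apply.
- by move=> y _; exact: integrable_mul_cos.
- apply: aeW => x _ y _ /=; move: y.
  have : continuous (fun y => g x * cos (2 * pi * y * x)) by cts.
  by [].
- exact: integrable_norm.
- move=> y _; apply: aeW => x _; rewrite normrM ler_piMr//.
  exact: cos_max.
- by rewrite inE/= in_itv/=; apply/andP; split; lra.
Qed.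

Lemma cosft_bounded g xi : mu.-integrable setT (EFin \o g) ->
  `|cosft g xi| <= \int[mu]_x `|g x|.
Proof.
move=> ig; rewrite (le_trans (le_normr_Rintegral _ _))//.
  exact: integrable_mul_cos.
apply: le_Rintegral => //.
- by apply: integrable_norm; exact: integrable_mul_cos.
- exact: integrable_norm.
- by move=> x _; rewrite normrM ler_piMr// cos_max.
Qed.

(** Fubini for g(x) h(y) cos (2 pi x y), which is dominated by |g(x)| |h(y)|. *)
Lemma cosft_mul g h : mu.-integrable setT (EFin \o g) ->
  mu.-integrable setT (EFin \o h) ->
  \int[mu]_xi (cosft g xi * h xi) = \int[mu]_x (g x * cosft h x).
Proof.
move=> ig ih.
have mg : measurable_fun setT g by apply/measurable_EFinP; exact: measurable_int ig.
have mh : measurable_fun setT h by apply/measurable_EFinP; exact: measurable_int ih.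
pose f (z : R * R) := g z.1 * (h z.2 * cos (2 * pi * z.1 * z.2)).
have mf : measurable_fun setT (EFin \o f).
  apply/measurable_EFinP; apply: measurable_funM.
    exact: measurableT_comp.
  apply: measurable_funM; first exact: measurableT_comp.
  apply: measurableT_comp.
    by apply: continuous_measurable_fun; exact: continuous_cos.
  by apply: measurable_funM => //; apply: measurable_funM.
have intf : (mu \x mu)%E.-integrable setT (EFin \o f).
  apply/integrable12ltyP => //.
  apply: (@le_lt_trans _ _ (\int[mu]_x (`|g x|%:E * \int[mu]_y `|(h y)%:E|))%E).
    apply: ge0_le_integral => //.
    - by move=> x _; exact: integral_ge0.
    - apply: (@measurable_fun_fubini_tonelli_F _ _ _ _ _ mu
        (abse \o (EFin \o f))); first exact: measurableT_comp.
      by move=> z; rewrite /= lee_fin.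
    - apply: emeasurable_funM => //.
      by apply/measurable_EFinP; exact: measurableT_comp.
    - move=> x _; rewrite -ge0_integralZl//; last first.
        by apply: measurableT_comp => //; exact/measurable_EFinP.
      apply: ge0_le_integral => //.
      + apply: measurableT_comp => //; apply/measurable_EFinP.
        rewrite /f /=; apply: measurable_funM; first exact: measurable_cst.
        by apply: measurable_funM => //; apply: continuous_measurable_fun; cts.
      + apply: emeasurable_funM => //; apply: measurableT_comp => //.
        exact/measurable_EFinP.
      + move=> y _ /=; rewrite lee_fin /f /= normrM ler_wpM2l//.
        by rewrite normrM ler_piMr// cos_max.
  have /integrableP[_ hoo] := ih; have /integrableP[_ goo] := ig.
  rewrite ge0_integralZr//; last 2 first.
    by apply/measurable_EFinP; exact: measurableT_comp.
    exact: integral_ge0.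
  apply: lte_mul_pinfty => //; first exact: integral_ge0.
  by rewrite ge0_fin_numE//; exact: integral_ge0.
have := Fubini intf.
rewrite /Rintegral => e; congr fine.
transitivity (\int[mu]_y \int[mu]_x (EFin \o f) (x, y))%E.
  apply: eq_integral => y _ /=; rewrite EFinM muleC.
  have iy : mu.-integrable setT (EFin \o (fun x => g x * cos (2 * pi * y * x))).
    exact: integrable_mul_cos.
  rewrite /cosft /Rintegral fineK; last exact: integrable_fin_num.
  rewrite -integralZl//; apply: eq_integral => x _ /=.
  by rewrite -EFinM /f /=; congr EFin; rewrite mulrCA -!mulrA (mulrC y x).
rewrite -e; apply: eq_integral => x _; rewrite EFinM.
have iy : mu.-integrable setT (EFin \o (fun y => h y * cos (2 * pi * x * y))).
  exact: integrable_mul_cos.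
rewrite /cosft /Rintegral fineK; last exact: integrable_fin_num.
by rewrite -integralZl//; apply: eq_integral => y _ /=; rewrite -EFinM.
Qed.

(** Away from 0 the kernel is O(a) times a fixed integrable kernel, which controls tails as a tends
    to 0. With q = (2 pi s)^2 >= r = (2 pi d)^2, the claim reduces to 1 + q <= (1 + 1/r) (a^2 + q),
    true because q / r >= 1. *)
Lemma poisson_le (a d s : R) : 0 < a -> 0 < d -> d <= `|s| ->
  poisson a s <= a * (1 + (2 * pi * d) ^- 2) * poisson 1 s.
Proof.
move=> a0 d0 ds.
have p0 : 0 < 2 * pi :> R by rewrite mulr_gt0// pi_gt0.
rewrite /poisson expr1n; set q := (2 * pi * s) ^+ 2; set r := (2 * pi * d) ^+ 2.
have r0 : 0 < r by rewrite exprn_gt0// mulr_gt0.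
have rq : r <= q.
  rewrite /r /q -[leRHS]real_normK ?num_real// ler_sqr ?nnegrE//.
    by rewrite normrM (gtr0_norm p0) ler_pM2l.
  by rewrite mulr_ge0// ltW.
have q0 : 0 < q by exact: lt_le_trans rq.
have a20 : 0 < a ^+ 2 by rewrite exprn_gt0.
rewrite ler_pdivrMr ?addr_gt0//.
have -> : a * (1 + r^-1) * (2 * 1 / (1 + q)) * (a ^+ 2 + q) =
    2 * a * ((1 + r^-1) * (a ^+ 2 + q) / (1 + q)).
  by field; rewrite gt_eqF ?addr_gt0//= gt_eqF.
rewrite ler_peMr ?mulr_ge0 ?(ltW a0)// ler_pdivlMr ?addr_gt0// mul1r.
have qr : 1 <= q / r by rewrite ler_pdivlMr// mul1r.
have : 0 <= a ^+ 2 * (1 + r^-1).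
  by rewrite mulr_ge0 ?(ltW a20)// addr_ge0// invr_ge0 ltW.
lra.
Qed.

Lemma poisson_bounded (a s : R) : 0 < a -> `|poisson a s| <= 2 / a.
Proof.
move=> a0; rewrite gtr0_norm ?poisson_gt0// /poisson.
rewrite ler_pdivrMr ?poisson_den_gt0//.
have {1}-> : 2 * a = 2 / a * a ^+ 2 by field; rewrite gt_eqF.
by rewrite ler_wpM2l ?lerDl ?sqr_ge0// divr_ge0// ltW.
Qed.

Lemma poisson1_le2 (s : R) : poisson 1 s <= 2.
Proof.
rewrite /poisson expr1n mulr1 ler_pdivrMr ?ltr_pwDl ?sqr_ge0//.
by have := sqr_ge0 (2 * pi * s); lra.
Qed.

(** The kernel has mass 1, so the difference is the integral of (g x - g t) against it. Within
    distance d of t continuity gives at most e; farther away [poisson_le] supplies a factor a. *)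
Lemma poisson_approx g (t e : R) : continuous g ->
  mu.-integrable setT (EFin \o g) -> 0 < e ->
  exists C, forall a, 0 < a ->
    `|\int[mu]_x (g x * poisson a (x - t)) - g t| <= e + a * C.
Proof.
move=> cg ig e0.
have /cvgrPdist_le/(_ _ e0) := cg t.
rewrite -nbhs_nearE => /nbhs_ballP[d /= d0 gd].
pose C2 := 1 + (2 * pi * d) ^- 2.
have C20 : 0 <= C2 by rewrite addr_ge0// invr_ge0 exprn_even_ge0.
(* The far part is at most a C2 (|g x| + |g t|) [poisson 1 (x - t)]. In the first term the kernel is
   bounded by 2, in the second it is integrated to 1. *)
exists (2 * C2 * \int[mu]_x `|g x| + C2 * `|g t|) => a a0.
have a0' := ltW a0; have e0' := ltW e0.
have pa0 s : 0 <= poisson a s by rewrite ltW// poisson_gt0.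
have p10 (s : R) : 0 <= poisson 1 s by rewrite ltW// poisson_gt0.
have pc b : 0 < b -> continuous (fun x => poisson b (x - t)).
  move=> b0; apply: (@cts_comp _ _ (poisson b) (fun x => x - t)); last by cts.
  exact: poisson_continuous.
have ip := integrable_poisson_shift a t a0.
have ip1 := integrable_poisson_shift 1 t ltr01.
have pbd s := poisson_bounded a s a0.
have igp : mu.-integrable setT (EFin \o (fun x => g x * poisson a (x - t))).
  by apply: (integrable_mul_continuous _ _ (2 / a) ig);
    [exact: pc|move=> x; exact: pbd].
have ign := integrable_norm ig.
have igt : mu.-integrable setT (EFin \o (fun x => g t * poisson a (x - t))).
  by have := integrableZl measurableT (g t) ip.
have -> : \int[mu]_x (g x * poisson a (x - t)) - g t =
    \int[mu]_x (g x * poisson a (x - t) - g t * poisson a (x - t)).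
  by rewrite RintegralB// RintegralZl// integral_poisson_shift// mulr1.
have igB : mu.-integrable setT
    (EFin \o (fun x => g x * poisson a (x - t) - g t * poisson a (x - t))).
  by have := integrableB measurableT igp igt.
rewrite (le_trans (le_normr_Rintegral _ _))//.
pose B x := e * poisson a (x - t) +
  (a * (2 * C2) * `|g x| + a * (C2 * `|g t|) * poisson 1 (x - t)).
have i1 : mu.-integrable setT (EFin \o (fun x => e * poisson a (x - t))).
  by have := integrableZl measurableT e ip.
have i2 : mu.-integrable setT (EFin \o (fun x => a * (2 * C2) * `|g x|)).
  by have := integrableZl measurableT (a * (2 * C2)) ign.
have i3 : mu.-integrable setT
    (EFin \o (fun x => a * (C2 * `|g t|) * poisson 1 (x - t))).
  by have := integrableZl measurableT (a * (C2 * `|g t|)) ip1.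
have i23 : mu.-integrable setT (EFin \o
    (fun x => a * (2 * C2) * `|g x| + a * (C2 * `|g t|) * poisson 1 (x - t))).
  by have := integrableD measurableT i2 i3.
have iB : mu.-integrable setT (EFin \o B).
  by have := integrableD measurableT i1 i23.
apply: (@le_trans _ _ (\int[mu]_x B x)).
  apply: le_Rintegral => //; first exact: integrable_norm.
  move=> x _; rewrite -mulrBl normrM (ger0_norm (pa0 _)) /B.
  have B2 : 0 <= a * (2 * C2) * `|g x| + a * (C2 * `|g t|) * poisson 1 (x - t).
    by apply: addr_ge0; do 3 (try apply: mulr_ge0 => //).
  have [xd|dx] := ltP `|x - t| d.
    apply: (@le_trans _ _ (e * poisson a (x - t))); last by rewrite lerDl.
    apply: ler_wpM2r => //; rewrite distrC; apply: gd.
    by rewrite /ball /= distrC.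
  apply: (@le_trans _ _ ((`|g x| + `|g t|) * poisson a (x - t))).
    by apply: ler_wpM2r => //; exact: ler_normB.
  apply: (@le_trans _ _ ((`|g x| + `|g t|) * (a * C2 * poisson 1 (x - t)))).
    by rewrite ler_wpM2l ?addr_ge0//; exact: poisson_le.
  apply: ler_wpDl; first exact: mulr_ge0.
  rewrite mulrDl; apply: lerD; last by rewrite mulrCA !mulrA mulrAC lexx.
  have -> : `|g x| * (a * C2 * poisson 1 (x - t)) =
            a * C2 * `|g x| * poisson 1 (x - t) by ring.
  have -> : a * (2 * C2) * `|g x| = a * C2 * `|g x| * 2 by ring.
  by rewrite ler_wpM2l ?poisson1_le2// !mulr_ge0// ltW.
rewrite /B RintegralD// RintegralD// (RintegralZl _ measurableT ip).
rewrite (RintegralZl _ measurableT ign) (RintegralZl _ measurableT ip1).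
rewrite !integral_poisson_shift//.
by clearbody C2; rewrite !mulr1 mulrDr !mulrA.
Qed.

(** Abel summation: the factors exp (-a|xi|), with a = 1/(n+1), are inserted into the inversion
    integral. Dominated convergence removes them in the limit, while the multiplication formula
    turns the damped integral into a Poisson average of g, which tends to g t. *)
Lemma cosft_inversion g t : continuous g -> (forall x, g (- x) = g x) ->
  mu.-integrable setT (EFin \o g) ->
  mu.-integrable setT (EFin \o cosft g) ->
  \int[mu]_xi (cosft g xi * cos (2 * pi * t * xi)) = g t.
Proof.
move=> cg gN ig iG.
pose a (n : nat) : R := n.+1%:R^-1.
have a0 n : 0 < a n by rewrite invr_gt0 ltr0n.
pose h n xi : R := expR (- (a n * `|xi|)) * cos (2 * pi * t * xi).
have ih n : mu.-integrable setT (EFin \o h n) by exact: integrable_exp_norm_cos.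
have ch n : continuous (h n) by rewrite /h; cts.
have abel n : \int[mu]_xi (cosft g xi * h n xi) =
              \int[mu]_x (g x * poisson (a n) (x - t)).
  rewrite cosft_mul//.
  (* The product of the two cosines splits into kernels centred at t and at -t; evenness of g later
     makes their contributions equal. *)
  have hE x : cosft (h n) x = 2^-1 * (poisson (a n) (x - t) + poisson (a n) (x + t)).
    have E s : poisson (a n) s =
        \int[mu]_y (expR (- (a n * `|y|)) * cos (2 * pi * s * y)).
      by rewrite integral_exp_norm_cos.
    rewrite !E -RintegralD//; [|exact: integrable_exp_norm_cos..].
    rewrite -RintegralZl//; last first.
      by have := integrableD measurableT
        (integrable_exp_norm_cos _ (2 * pi * (x - t)) (a0 n))
        (integrable_exp_norm_cos _ (2 * pi * (x + t)) (a0 n)).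
    apply: eq_Rintegral => y _; rewrite /h -mulrA.
    have -> : 2 * pi * (x - t) * y = 2 * pi * x * y - 2 * pi * t * y by ring.
    have -> : 2 * pi * (x + t) * y = 2 * pi * x * y + 2 * pi * t * y by ring.
    by rewrite cosB cosD; field.
  have pc u : continuous (fun x => poisson (a n) (x + u)).
    apply: (@cts_comp _ _ (poisson (a n)) (fun x => x + u)); last by cts.
    exact: poisson_continuous.
  have pbd s := poisson_bounded _ s (a0 n).
  have igp u : mu.-integrable setT (EFin \o (fun x => g x * poisson (a n) (x + u))).
    by apply: (integrable_mul_continuous _ _ (2 / a n) ig);
      [exact: pc|move=> x; exact: pbd].
  under eq_Rintegral do rewrite hE mulrCA mulrDr.
  rewrite RintegralZl//; last by have := integrableD measurableT (igp (- t)) (igp t).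
  rewrite RintegralD//.
  have <- : \int[mu]_x (g x * poisson (a n) (x - t)) =
            \int[mu]_x (g x * poisson (a n) (x + t)).
    rewrite -[RHS]Rintegral_oppr//; last by apply: cts_mul => //; exact: pc.
    by apply: eq_Rintegral => x _; rewrite gN -poissonN opprD opprK.
  lra.
have lhs : \int[mu]_xi (cosft g xi * h n xi) @[n --> \oo] -->
           \int[mu]_xi (cosft g xi * cos (2 * pi * t * xi)).
  have cG := cosft_continuous _ ig.
  apply: fine_cvg.
  rewrite -/(Rintegral _ _ _).
  have iGc : mu.-integrable setT
      (EFin \o (fun xi => cosft g xi * cos (2 * pi * t * xi))).
    exact: integrable_mul_cos.
  rewrite /Rintegral fineK; last exact: integrable_fin_num.
  apply: (@dominated_cvg _ _ _ mu setT measurableT _ _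
    (fun xi => `|cosft g xi|%:E)).
  - move=> n; apply/measurable_EFinP; apply: continuous_measurable_fun.
    exact: cts_mul.
  - move=> xi _; apply: cvg_EFin; first by apply: nearW.
    rewrite /=; apply: cvgM; first exact: cvg_cst.
    rewrite -[X in _ --> X]mul1r; apply: cvgM; last exact: cvg_cst.
    rewrite -(@expR0 R); apply: continuous_cvg; first exact: continuous_expR.
    rewrite -oppr0 -(mul0r `|xi|); apply: cvgN; apply: cvgM; last exact: cvg_cst.
    exact: cvg_harmonic.
  - by [].
  - exact: integrable_norm.
  - move=> n xi _ /=; rewrite lee_fin normrM ler_piMr// normrM.
    rewrite mulr_ile1// ?cos_max// ger0_norm ?expR_ge0// expR_le1.
    by rewrite oppr_le0 mulr_ge0// ltW.
have rhs : \int[mu]_xi (cosft g xi * h n xi) @[n --> \oo] --> g t.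
  apply/cvgrPdist_le => e e0.
  have e20 : 0 < e / 2 by lra.
  have [C gC] := poisson_approx _ t _ cg ig e20.
  have aC : a n * C @[n --> \oo] --> 0.
    rewrite -[X in _ --> X](mul0r C); apply: cvgM; last exact: cvg_cst.
    exact: cvg_harmonic.
  near=> n; rewrite abel distrC (le_trans (gC _ (a0 n)))//.
  have : `|0 - a n * C| <= e / 2 by near: n; move/cvgrPdist_le: aC; exact.
  by rewrite sub0r normrN => /(le_trans (ler_norm _)); lra.
exact: (cvg_unique _ lhs rhs).
Unshelve. all: by end_near. Qed.

End cosine_transform.

(** * Admissible functions *)

Section fourier_even.
Context {R : realType}.
Local Notation mu := (@lebesgue_measure R).
Implicit Types g : R -> R.

Lemma Re_fourier g (xi : R) : complex.Re (fourier g xi) = cosft g xi.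
Proof.
rewrite /fourier /Cintegral /=; apply: eq_Rintegral => x _ /=.
by rewrite cosN mulr0 subr0 mulrC.
Qed.

Lemma Im_fourier_even g (xi : R) : continuous g -> (forall x, g (- x) = g x) ->
  mu.-integrable setT (EFin \o g) -> complex.Im (fourier g xi) = 0.
Proof.
move=> cg gN ig; rewrite /fourier /Cintegral /=.
transitivity (\int[mu]_x (g x * sin (- (2 * pi * xi) * x))).
  apply: eq_Rintegral.
  by move=> x _ /=; rewrite mulr0 add0r mulrC mulNr.
apply: Rintegral_odd; [by cts|exact: integrable_mul_sin|].
by move=> x; rewrite gN mulrN sinN mulrN.
Qed.

Lemma Re_fourier_fun g : (fun xi => complex.Re (fourier g xi)) = cosft g.
Proof. by apply/funext => xi; exact: Re_fourier. Qed.

Lemma admissibleP (Delta : R) g : admissible Delta g <->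
  [/\ continuous g, (forall x, g (- x) = g x) & mu.-integrable setT (EFin \o g)] /\
  [/\ mu.-integrable setT (EFin \o cosft g),
      (forall alpha, Delta < `|alpha| -> cosft g alpha <= 0)
    & (forall x, 0 <= g x)].
Proof.
split=> -[[cg gN ig] [iG Gle g0]]; split; split=> //.
- by case: iG => + _; rewrite Re_fourier_fun.
- by move=> al /Gle; rewrite lecE => /andP[_]; rewrite Re_fourier.
- split; first by rewrite Re_fourier_fun.
  rewrite (_ : (fun x => _) = fun=> 0); first exact: integrable0.
  by apply/funext => xi; rewrite Im_fourier_even.
- by move=> al /Gle; rewrite lecE Re_fourier Im_fourier_even// eqxx.
Qed.

(** Inversion applied to exp (-a|y|), whose transform is the Poisson kernel. *)
Lemma cosft_poisson (a t : R) : 0 < a -> cosft (poisson a) t = expR (- (a * `|t|)).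
Proof.
move=> a0; pose h (y : R) := expR (- (a * `|y|)).
have hE : cosft h = poisson a.
  by apply/funext => xi; rewrite /cosft /h integral_exp_norm_cos.
have := @cosft_inversion R h t; rewrite hE; apply.
- by rewrite /h; cts.
- by move=> y; rewrite /h normrN.
- exact: integrable_exp_norm.
- exact: integrable_poisson.
Qed.

(* With [P_a] the Poisson kernel, [2 a P_a - P_1] is positive for [a >= 1], and
   its transform [2 a exp (-a|t|) - exp (-|t|)] is negative outside
   [-Delta, Delta] once [a] is large. *)
Lemma admissible_nonempty (Delta : R) : 0 < Delta ->
  exists g, admissible Delta g /\ 0 < g 0.
Proof.
(* This value yields ((a - 1) Delta / 2)^2 = 4 a + Delta^2 / 4, which exceeds the factor 2 a that
   has to be beaten outside [-Delta, Delta]. *)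
move=> D0; pose a : R := 2 + 16 / Delta ^+ 2.
have D20 : 0 < Delta ^+ 2 by rewrite exprn_gt0.
have q0 : 0 < 16 / Delta ^+ 2 by rewrite divr_gt0.
have a2 : 2 < a by rewrite ltrDl.
have a0 : 0 < a by lra.
have aE : (a - 1) * (Delta ^+ 2 / 4) = 4 + Delta ^+ 2 / 4.
  by rewrite /a; field; rewrite gt_eqF.
clearbody a.
have o0 : (0 : R) < 1 by [].
pose g x := 2 * a * poisson a x - poisson 1 x.
have cpa := poisson_continuous _ a0; have cp1 := poisson_continuous _ o0.
have ipa := integrable_poisson _ a0; have ip1 := integrable_poisson _ o0.
have ipa2 : mu.-integrable setT (EFin \o (fun x => 2 * a * poisson a x)).
  by have := integrableZl measurableT (2 * a) ipa.
have ig : mu.-integrable setT (EFin \o g).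
  by have := integrableB measurableT ipa2 ip1.
have cg : continuous g.
  by apply: cts_add; [apply: cts_mul => //; exact: cts_cst|exact: cts_opp].
have GE t : cosft g t = 2 * a * expR (- (a * `|t|)) - expR (- (1 * `|t|)).
  rewrite -!cosft_poisson// /cosft /g.
  rewrite -RintegralZl//; last exact: integrable_mul_cos.
  rewrite -RintegralB//.
  - by apply: eq_Rintegral => x _; rewrite mulrBl mulrA.
  - by have := integrableZl measurableT (2 * a)
      (integrable_mul_cos (poisson a) (2 * pi * t) ipa).
  - exact: integrable_mul_cos.
exists g; split; last first.
  rewrite /g /poisson !mulr0 expr0n /= !addr0 expr1n.
  have -> : 2 * a * (2 * a / a ^+ 2) = 4 by field; rewrite gt_eqF.
  lra.
apply/admissibleP; split; split => //.
- by move=> x; rewrite /g !poissonN.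
- have i1 : mu.-integrable setT (EFin \o (fun t => 2 * a * expR (- (a * `|t|)))).
    by have := integrableZl measurableT (2 * a) (integrable_exp_norm _ a0).
  have -> : cosft g = fun t => 2 * a * expR (- (a * `|t|)) - expR (- (1 * `|t|)).
    by apply/funext.
  by have := integrableB measurableT i1 (integrable_exp_norm _ o0).
- move=> t Dt; rewrite GE subr_le0.
  have -> : - (1 * `|t|) = (a - 1) * `|t| + - (a * `|t|) by ring.
  rewrite expRD ler_wpM2r ?expR_ge0//.
  (* Halving the exponent and squaring 1 + x <= exp x gives a lower bound quadratic in (a - 1)
     Delta; a linear one would not reach 2 a for small Delta. *)
  have -> : (a - 1) * `|t| = (a - 1) * `|t| / 2 + (a - 1) * `|t| / 2 by field.
  rewrite expRD -expr2.
  have le1 : (a - 1) * Delta / 2 <= (a - 1) * `|t| / 2.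
    by rewrite ler_pM2r ?invr_gt0// ler_pM2l ?(ltW Dt)//; lra.
  have e1 := expR_ge1Dx ((a - 1) * `|t| / 2).
  have e2 : 0 <= (a - 1) * Delta / 2.
    by rewrite divr_ge0// mulr_ge0 ?(ltW D0)//; lra.
  apply: (@le_trans _ _ (((a - 1) * Delta / 2) ^+ 2)); last first.
    by rewrite ler_sqr ?nnegrE ?expR_ge0//; lra.
  have -> : ((a - 1) * Delta / 2) ^+ 2 = (a - 1) ^+ 2 * (Delta ^+ 2 / 4) by field.
  rewrite expr2 -mulrA aE mulrDr aE; lra.
- move=> x; rewrite /g subr_ge0 /poisson expr1n.
  have := sqr_ge0 (2 * pi * x); move: ((2 * pi * x) ^+ 2) => q qge0.
  have aa0 : 0 < a ^+ 2 + q by rewrite ltr_pwDl// exprn_gt0.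
  rewrite ler_pdivrMr; last by lra.
  rewrite mulr1 mulrAC mulrA ler_pdivlMr//.
  have a21 : 1 <= a ^+ 2 by rewrite expr_ge1//; lra.
  have : 0 <= (a ^+ 2 - 1) * q by rewrite mulr_ge0// subr_ge0.
  rewrite mulrBl mul1r => h.
  have h2 : 0 <= a ^+ 2 * q by rewrite mulr_ge0// ltW// exprn_gt0.
  have -> : 2 * a * (1 + q) * (2 * a) = 4 * a ^+ 2 + 4 * (a ^+ 2 * q) by ring.
  lra.
Qed.

End fourier_even.

(** * Pair sums and the form factor *)

Section finite_sums.
Context {R : realType}.
Local Notation mu := (@lebesgue_measure R).

Lemma integrable_sumR (I : Type) (s : seq I) (f : I -> R -> R) :
  (forall i, mu.-integrable setT (EFin \o f i)) ->
  mu.-integrable setT (EFin \o (fun y => \sum_(i <- s) f i y)).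
Proof.
move=> fi; have := @integrable_sum _ _ _ mu setT measurableT _ s xpredT
  (fun i => EFin \o f i) (fun i _ => fi i).
by apply: eq_integrable => // y _ /=; rewrite -sumEFin.
Qed.

Lemma Rintegral_sum (I : Type) (s : seq I) (f : I -> R -> R) :
  (forall i, mu.-integrable setT (EFin \o f i)) ->
  \int[mu]_y (\sum_(i <- s) f i y) = \sum_(i <- s) \int[mu]_y f i y.
Proof.
move=> fi; elim: s => [|i s ih].
  rewrite big_nil; under eq_Rintegral do rewrite big_nil.
  by rewrite Rintegral_cst// mul0r.
rewrite big_cons -ih; under eq_Rintegral do rewrite big_cons.
by rewrite RintegralD//; exact: integrable_sumR.
Qed.

End finite_sums.

Section pair_sums.
Context {R : realType}.
Local Notation mu := (@lebesgue_measure R).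
Variables (s : seq nat) (x : nat -> R) (k N : R).
Hypothesis N0 : 0 < N.
Implicit Types phi psi : R -> R.

(** In the application k is [lambda * ln T] and N the normalization, so that phi is evaluated at the
    frequency, in alpha, of each pair of ordinates. *)
Definition pairsum phi : R := N^-1 *
  \sum_(n <- s) \sum_(m <- s) weight (x n - x m) * phi (k * (x n - x m)).

Lemma weight_gt0 (u : R) : 0 < weight u.
Proof. by rewrite divr_gt0// ltr_pwDl// sqr_ge0. Qed.

Lemma le_pairsum phi psi : (forall c, phi c <= psi c) ->
  pairsum phi <= pairsum psi.
Proof.
move=> h; rewrite /pairsum ler_wpM2l ?invr_ge0 ?(ltW N0)//.
apply: ler_sum => n _; apply: ler_sum => m _.
by rewrite ler_wpM2l ?(ltW (weight_gt0 _)).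
Qed.

Lemma eq_pairsum phi psi : phi =1 psi -> pairsum phi = pairsum psi.
Proof. by move=> /funext ->. Qed.

Lemma pairsumZ a phi : pairsum (fun c => a * phi c) = a * pairsum phi.
Proof.
rewrite /pairsum mulrCA; congr (_ * _); rewrite mulr_sumr.
apply: eq_bigr => n _; rewrite mulr_sumr; apply: eq_bigr => m _.
by rewrite mulrCA.
Qed.

Lemma pairsumD phi psi :
  pairsum (fun c => phi c + psi c) = pairsum phi + pairsum psi.
Proof.
rewrite /pairsum -mulrDr -big_split; congr (_ * _); apply: eq_bigr => n _ /=.
by rewrite -big_split; apply: eq_bigr => m _ /=; rewrite mulrDr.
Qed.

Lemma pairsumN phi : pairsum (fun c => - phi c) = - pairsum phi.
Proof.
by rewrite -mulN1r -pairsumZ; apply: eq_pairsum => c; rewrite mulN1r.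
Qed.

Lemma Rintegral_pairsum (h : R -> R -> R) :
  (forall c, mu.-integrable setT (EFin \o h c)) ->
  \int[mu]_u pairsum (fun c => h c u) = pairsum (fun c => \int[mu]_u h c u).
Proof.
move=> ih.
have i1 n m : mu.-integrable setT
    (EFin \o (fun u => weight (x n - x m) * h (k * (x n - x m)) u)).
  by apply: (integrableZl measurableT _ (f := EFin \o _)).
rewrite /pairsum RintegralZl//; last first.
  by apply: integrable_sumR => n; apply: integrable_sumR => m.
congr (_ * _); rewrite Rintegral_sum; last by move=> n; exact: integrable_sumR.
apply: eq_bigr => n _; rewrite Rintegral_sum//; apply: eq_bigr => m _.
by rewrite RintegralZl.
Qed.

Lemma cts_pairsum (h : R -> R -> R) : (forall c, continuous (h c)) ->
  continuous (fun u => pairsum (fun c => h c u)).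
Proof.
move=> ch; apply: cts_mul; first exact: cts_cst.
have cts_sum (f : nat -> R -> R) : (forall n, continuous (f n)) ->
    continuous (fun u => \sum_(n <- s) f n u).
  move=> cf; elim: s => [|n r ih].
    by under eq_fun do rewrite big_nil; exact: cts_cst.
  by under eq_fun do rewrite big_cons; exact: cts_add.
apply: (cts_sum) => n; apply: (cts_sum) => m.
by apply: cts_mul; [exact: cts_cst|exact: ch].
Qed.

Definition ffactor (al : R) : R := pairsum (fun c => cos (c * al)).

Lemma ffactor_continuous : continuous ffactor.
Proof. by apply: cts_pairsum => c; cts. Qed.

Lemma ffactor_bounded al : `|ffactor al| <= pairsum (fun=> 1).
Proof.
rewrite ler_norml; apply/andP; split; last by apply: le_pairsum => c; exact: cos_le1.
rewrite -pairsumN; apply: le_pairsum => c; exact: cos_geN1.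
Qed.

(** The double sum is the squared modulus of the exponential sum with frequencies x n at th. *)
Lemma cos_sum_ge0 (th : R) :
  0 <= \sum_(n <- s) \sum_(m <- s) cos ((x n - x m) * th).
Proof.
have -> : \sum_(n <- s) \sum_(m <- s) cos ((x n - x m) * th) =
    (\sum_(n <- s) cos (x n * th)) ^+ 2 + (\sum_(n <- s) sin (x n * th)) ^+ 2.
  rewrite !expr2 !mulr_suml -big_split; apply: eq_bigr => n _ /=.
  rewrite !mulr_sumr -big_split; apply: eq_bigr => m _ /=.
  by rewrite mulrBl cosB.
by rewrite addr_ge0// sqr_ge0.
Qed.

(* [weight] is the cosine transform of [exp (-2|y|)], hence positive definite. *)
Lemma ffactor_ge0 al : 0 <= ffactor al.
Proof.
rewrite /ffactor /pairsum mulr_ge0 ?invr_ge0 ?(ltW N0)//.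
pose f n m (y : R) := expR (- (2 * `|y|)) * cos ((x n - x m) * y) *
  cos (k * (x n - x m) * al).
have fi n m : mu.-integrable setT (EFin \o f n m).
  apply: (integrable_mul_continuous _ _ 1); last by move=> ?; exact: cos_max.
    exact: integrable_exp_norm_cos.
  exact: cts_cst.
have -> : \sum_(n <- s) \sum_(m <- s) weight (x n - x m) * cos (k * (x n - x m) * al)
    = \int[mu]_y \sum_(n <- s) \sum_(m <- s) f n m y.
  rewrite Rintegral_sum; last by move=> n; exact: integrable_sumR.
  apply: eq_bigr => n _; rewrite Rintegral_sum//; apply: eq_bigr => m _.
  rewrite RintegralZr//; last exact: integrable_exp_norm_cos.
  rewrite integral_exp_norm_cos//; congr (_ * _); rewrite /weight.
  by congr (_ / (_ + _)); ring.
apply: Rintegral_ge0 => y _.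
(* For fixed y, product-to-sum turns the two cosines into half of A + B, and each of these is a
   squared modulus. *)
pose A := \sum_(n <- s) \sum_(m <- s) cos ((x n - x m) * (y + k * al)).
pose B := \sum_(n <- s) \sum_(m <- s) cos ((x n - x m) * (y - k * al)).
have -> : \sum_(n <- s) \sum_(m <- s) f n m y = expR (- (2 * `|y|)) / 2 * (A + B).
  rewrite /A /B -big_split mulr_sumr; apply: eq_bigr => n _ /=.
  rewrite -big_split mulr_sumr; apply: eq_bigr => m _ /=.
  rewrite /f; move: (x n - x m) => d.
  rewrite (_ : k * d * al = d * (k * al)); last by ring.
  by rewrite (mulrBr d) (mulrDr d) cosB cosD; field.
by rewrite mulr_ge0 ?divr_ge0 ?expR_ge0// addr_ge0// cos_sum_ge0.
Qed.

(** The primitive of [ffactor] that vanishes at 0: each term is sin (c t) / c, written so that it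
    equals t when c = 0. *)
Definition Ffactor (t : R) : R := pairsum (fun c => t * sinc (c * t)).

Lemma has_der_pairsum (h dh : R -> R -> R) (t : R) :
  (forall c, has_der (h c) t (dh c t)) ->
  has_der (fun u => pairsum (fun c => h c u)) t (pairsum (fun c => dh c t)).
Proof.
move=> hd.
have der_sum (f df : nat -> R -> R) : (forall n, has_der (f n) t (df n t)) ->
    has_der (fun u => \sum_(n <- s) f n u) t (\sum_(n <- s) df n t).
  move=> fd; elim: s => [|n r ih].
    rewrite big_nil (_ : (fun u => _) = fun=> 0); first exact: der_cst.
    by apply/funext => u; rewrite big_nil.
  have -> : (fun u => \sum_(j <- n :: r) f j u) =
      fun u => f n u + \sum_(j <- r) f j u.
    by apply/funext => u; rewrite big_cons.
  by rewrite big_cons; apply: der_add; [exact: fd|exact: ih].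
have der_scale (a : R) (f df : R -> R) : has_der f t (df t) ->
    has_der (fun u => a * f u) t (a * df t).
  move=> fd; apply: der_eq; first by apply: der_mul; [exact: der_cst|exact: fd].
  by rewrite mulr0 addr0.
apply: (der_scale _
  (fun u => \sum_(n <- s) \sum_(m <- s)
              weight (x n - x m) * h (k * (x n - x m)) u)
  (fun u => \sum_(n <- s) \sum_(m <- s)
              weight (x n - x m) * dh (k * (x n - x m)) u)).
apply: (der_sum (fun n u => \sum_(m <- s) weight (x n - x m) * h (k * (x n - x m)) u)
  (fun n u => \sum_(m <- s) weight (x n - x m) * dh (k * (x n - x m)) u)) => n.
apply: (der_sum (fun m u => weight (x n - x m) * h (k * (x n - x m)) u)
  (fun m u => weight (x n - x m) * dh (k * (x n - x m)) u)) => m.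
exact: der_scale.
Qed.

Lemma Ffactor_der t : has_der Ffactor t (ffactor t).
Proof.
apply: (has_der_pairsum (fun c t => t * sinc (c * t)) (fun c t => cos (c * t))) => c.
have [->|c0] := eqVneq c 0.
  rewrite (_ : (fun u => _) = fun u => u); last first.
    by apply/funext => u; rewrite mul0r /sinc eqxx mulr1.
  by rewrite mul0r cos0; exact: der_id.
rewrite (_ : (fun u => _) = fun u => c^-1 * sin (c * u)); last first.
  apply/funext => u; rewrite /sinc mulf_eq0 (negPf c0) /=.
  have [->|u0] := eqVneq u 0; first by rewrite mulr0 sin0 mul0r mulr0.
  by field; rewrite c0.
by apply: der_eq; [der|rewrite /=; field].
Qed.

Lemma FfactorN t : Ffactor (- t) = - Ffactor t.
Proof.
rewrite -pairsumN; apply: eq_pairsum => c.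
by rewrite mulNr /sinc mulrN oppr_eq0 sinN invrN mulrNN.
Qed.

Lemma ffactor_integral (a b : R) : a <= b ->
  \int[mu]_(al in `[a, b]) ffactor al = Ffactor b - Ffactor a.
Proof.
by move=> ab; apply: Rintegral_FTC; [|exact: ffactor_continuous|exact: Ffactor_der].
Qed.

Lemma Ffactor_continuous : continuous Ffactor.
Proof.
move=> t; apply: differentiable_continuous; apply/derivable1_diffP.
by case: (Ffactor_der t).
Qed.

Lemma le_Ffactor a b : a <= b -> Ffactor a <= Ffactor b.
Proof.
move=> ab; rewrite -subr_ge0 -ffactor_integral//; apply: Rintegral_ge0 => t _.
exact: ffactor_ge0.
Qed.

Lemma Ffactor_diff (t l : R) : Ffactor (t + l / 2) - Ffactor (t - l / 2) =
  pairsum (fun c => l * sinc (c * l / 2) * cos (c * t)).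
Proof.
rewrite /Ffactor -pairsumN -pairsumD; apply: eq_pairsum => c.
have sincE u : u * sinc (c * u) = if c == 0 then u else sin (c * u) / c.
  rewrite /sinc mulf_eq0; have [->|c0] /= := eqVneq c 0; first by rewrite mulr1.
  have [->|u0] := eqVneq u 0; first by rewrite mulr0 sin0 !mul0r.
  by field; rewrite c0.
rewrite !sincE; have -> : c * l / 2 = c * (l / 2) by rewrite mulrA.
have -> : l * sinc (c * (l / 2)) = 2 * (l / 2 * sinc (c * (l / 2))) by field.
rewrite sincE; have [->|c0] := eqVneq c 0; first by rewrite mul0r cos0; field.
by rewrite mulrBr sinB mulrDr sinD; field.
Qed.

(** Expanding cos (c (u + m)) leaves only the product of cosines, since h is even and the sine part
    is odd. The multiplier A is 1 for the form factor and L [sinc (c L / 2)] for its integrals over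
    intervals of length L. *)
Lemma integral_ffactor_mul (h A : R -> R) (m : R) :
  continuous h -> (forall u, h (- u) = h u) -> mu.-integrable setT (EFin \o h) ->
  \int[mu]_u (h u * pairsum (fun c => A c * cos (c * (u + m)))) =
  pairsum (fun c => A c * cos (c * m) * \int[mu]_u (h u * cos (c * u))).
Proof.
move=> ch hN ih.
under eq_Rintegral do rewrite -pairsumZ.
rewrite (Rintegral_pairsum (fun c u => h u * (A c * cos (c * (u + m))))); last first.
  move=> c; apply: (integrable_mul_continuous _ _ `|A c| ih); first by cts.
  by move=> u; rewrite normrM ler_piMr// cos_max.
apply: eq_pairsum => c.
have ic : mu.-integrable setT (EFin \o (fun u => h u * cos (c * u))).
  apply: (integrable_mul_continuous _ _ 1 ih); first by cts.
  by move=> u; exact: cos_max.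
have isn : mu.-integrable setT (EFin \o (fun u => h u * sin (c * u))).
  apply: (integrable_mul_continuous _ _ 1 ih); first by cts.
  by move=> u; exact: sin_max.
have is0 : \int[mu]_u (h u * sin (c * u)) = 0.
  by apply: Rintegral_odd; [cts|exact: isn|move=> u; rewrite hN mulrN sinN mulrN].
transitivity (\int[mu]_u (A c * cos (c * m) * (h u * cos (c * u)) -
    A c * sin (c * m) * (h u * sin (c * u)))).
  by apply: eq_Rintegral => u _; rewrite mulrDr cosD; ring.
rewrite RintegralB//.
- by rewrite (RintegralZl _ _ ic)// (RintegralZl _ _ isn)// is0 mulr0 subr0.
- by apply: (integrableZl measurableT _ (f := EFin \o _)).
- by apply: (integrableZl measurableT _ (f := EFin \o _)).
Qed.

End pair_sums.

(** * Local bounds *)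

Section triangle.
Context {R : realType}.
Local Notation mu := (@lebesgue_measure R).

Lemma integrable_itv (f : R -> R) (a b : R) : continuous f ->
  mu.-integrable `[a, b] (EFin \o f).
Proof.
move=> cf; apply: continuous_compact_integrable; first exact: segment_compact.
exact: continuous_subspaceT.
Qed.

Lemma le_Rintegral_itvT (f g : R -> R) (a b : R) : continuous f -> continuous g ->
  mu.-integrable setT (EFin \o g) -> (forall t, 0 <= g t) ->
  (forall t, a <= t <= b -> f t <= g t) ->
  \int[mu]_(t in `[a, b]) f t <= \int[mu]_t g t.
Proof.
move=> cf cg ig g0 fg.
apply: (@le_trans _ _ (\int[mu]_(t in `[a, b]) g t)).
  by apply: le_Rintegral => //; exact: integrable_itv.
rewrite Rintegral_mkcond; apply: le_Rintegral => //.
  rewrite -restrict_EFin; apply/integrable_restrict => //.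
  by rewrite setTI; exact: integrable_itv.
by move=> t _; rewrite /patch; case: ifP.
Qed.

Definition tri (a u : R) : R := Num.max (a - `|u|) 0.

Lemma tri_continuous a : continuous (tri a).
Proof. by rewrite /tri; cts. Qed.

Lemma tri_ge0 a u : 0 <= tri a u.
Proof. by rewrite /tri le_max lexx orbT. Qed.

Lemma triN a u : tri a (- u) = tri a u.
Proof. by rewrite /tri normrN. Qed.

Lemma tri_in a u : `|u| <= a -> tri a u = a - `|u|.
Proof. by move=> ua; rewrite /tri; apply/max_idPl; rewrite subr_ge0. Qed.

Lemma tri_out a u : a <= `|u| -> tri a u = 0.
Proof. by move=> ua; rewrite /tri; apply/max_idPr; rewrite subr_le0. Qed.

Let tri_restrict a (f : R -> R) :
  (fun u => tri a u * f u) = (fun u => tri a u * f u) \_ `[- a, a].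
Proof.
apply/funext => u; rewrite /patch; case: ifPn => //.
rewrite notin_setE/= in_itv/= => /negP; rewrite -ler_norml -ltNge => /ltW ua.
by rewrite tri_out// mul0r.
Qed.

Lemma integrable_tri a (f : R -> R) : continuous f ->
  mu.-integrable setT (EFin \o (fun u => tri a u * f u)).
Proof.
move=> cf; rewrite tri_restrict -restrict_EFin; apply/integrable_restrict => //.
rewrite setTI; apply: integrable_itv.
by apply: cts_mul => //; exact: tri_continuous.
Qed.

(** The transform of the triangle is a Fejer kernel: for c != 0 each half contributes (1 - cos (c
    a)) / c^2. *)
Lemma tri_cos_ge0 a c : 0 < a -> 0 <= \int[mu]_u (tri a u * cos (c * u)).
Proof.
move=> a0; have [->|c0] := eqVneq c 0.
  by apply: Rintegral_ge0 => u _; rewrite mul0r cos0 mulr1 tri_ge0.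
have ct : continuous (fun u => tri a u * cos (c * u)).
  by apply: cts_mul; [exact: tri_continuous|cts].
rewrite tri_restrict -Rintegral_mkcond.
rewrite (@itv_bndbnd_setU _ _ _ (BRight 0)) ?bnd_simp ?oppr_le0 ?(ltW a0)//.
rewrite Rintegral_setU//; last 2 first.
- rewrite -itv_bndbnd_setU ?bnd_simp ?oppr_le0 ?(ltW a0)//.
  exact: integrable_itv.
- apply: lt_disjoint => u v; rewrite !in_itv/= => /andP[_ u0] /andP[v0 _].
  exact: le_lt_trans v0.
rewrite Rintegral_itv_obnd_cbnd; last first.
  apply: integrableS (integrable_itv _ 0 a ct) => // u /=.
  by rewrite !in_itv/= => /andP[/ltW -> ->].
have e1 : \int[mu]_(u in `[0, a]) (tri a u * cos (c * u)) =
    (1 - cos (c * a)) / c ^+ 2.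
  pose F u := (a - u) * (sin (c * u) / c) - cos (c * u) / c ^+ 2.
  transitivity (\int[mu]_(u in `[0, a]) ((a - u) * cos (c * u))).
    apply: eq_Rintegral => u; rewrite inE/= in_itv/= => /andP[u0 ua].
    by rewrite tri_in ger0_norm.
  rewrite (Rintegral_FTC _ F)//; [|exact: ltW|by cts|].
    by rewrite /F !mulr0 sin0 cos0; field.
  by move=> u; rewrite /F; apply: der_eq; [der|rewrite /=; field].
have e2 : \int[mu]_(u in `[- a, 0]) (tri a u * cos (c * u)) =
    (1 - cos (c * a)) / c ^+ 2.
  pose F u := (a + u) * (sin (c * u) / c) + cos (c * u) / c ^+ 2.
  transitivity (\int[mu]_(u in `[- a, 0]) ((a + u) * cos (c * u))).
    apply: eq_Rintegral => u; rewrite inE/= in_itv/= => /andP[ua u0].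
    by rewrite tri_in ler0_norm// ?opprK// lerNl.
  rewrite (Rintegral_FTC _ F)//; [|by rewrite oppr_le0 ltW|by cts|].
    by rewrite /F !mulr0 mulrN cosN sin0 cos0; field.
  by move=> u; rewrite /F; apply: der_eq; [der|rewrite /=; field].
rewrite e1 e2 addr_ge0// divr_ge0 ?sqr_ge0// subr_ge0 cos_le1//.
Qed.

End triangle.

Section tail.
Context {R : realType}.
Local Notation mu := (@lebesgue_measure R).

(** With v = 1/L, this is the relative cost of shifting an interval of length L by u: L [rho L^-1 u]
    is the minimum of 2 (|u| + 1) and L + 1. *)
Definition rho (v u : R) : R := Num.min (2 * (`|u| + 1) * v) (1 + v).

(** Dominated convergence along v = 1/(n+1), with majorant 2 |G|; since [rho] increases with v, one
    good n serves every L >= n+1. *)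
Lemma integral_rho_small (G : R -> R) (e : R) : continuous G ->
  mu.-integrable setT (EFin \o G) -> 0 < e ->
  exists2 L0 : R, 1 <= L0 &
    forall L, L0 <= L -> \int[mu]_u (`|G u| * rho L^-1 u) <= e.
Proof.
move=> cG iG e0.
have crho v : continuous (rho v : R -> R).
  by rewrite /rho; cts.
have rho_ge0 v u : 0 <= v -> 0 <= rho v u :> R.
  by move=> v0; rewrite /rho le_min !mulr_ge0// ?addr_ge0.
have rho_le v u : rho v u <= 1 + v :> R by rewrite /rho ge_min lexx orbT.
have le_rho v w u : v <= w -> rho v u <= rho w u :> R.
  move=> vw; rewrite /rho le_min !ge_min lerD2l vw orbT andbT.
  by rewrite ler_wpM2l// mulr_ge0// addr_ge0.
have iGn := integrable_norm iG.
have irho v : 0 <= v -> mu.-integrable setT (EFin \o (fun u => `|G u| * rho v u)).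
  move=> v0; apply: (integrable_mul_continuous _ _ (1 + v) iGn) => //.
  by move=> u; rewrite ger0_norm ?rho_ge0.
pose v n : R := n.+1%:R^-1.
have v0 n : 0 <= v n by rewrite invr_ge0.
have v1 n : v n <= 1 by rewrite invf_le1 ?ltr0n// ler1n.
have lim : \int[mu]_u (`|G u| * rho (v n) u) @[n --> \oo] --> (0 : R).
  apply: fine_cvg.
  have -> : (0 : R)%:E = (\int[mu]_u 0%:E)%E by rewrite integral0.
  apply: (@dominated_cvg _ _ _ mu setT measurableT _ _
    (fun u => (2 * `|G u|)%:E)).
  - move=> n; apply/measurable_EFinP; apply: continuous_measurable_fun.
    by apply: cts_mul => //; cts.
  - move=> u _; apply: cvg_EFin; first by apply: nearW.
    rewrite /= -[X in _ --> X](mulr0 `|G u|); apply: cvgM; first exact: cvg_cst.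
    apply: (@squeeze_cvgr _ _ _ _ (cst 0) (fun n => 2 * (`|u| + 1) * v n)).
    + by near=> n; rewrite rho_ge0//= /rho ge_min lexx.
    + exact: cvg_cst.
    + rewrite -[X in _ --> X](mulr0 (2 * (`|u| + 1))).
      by apply: cvgM; [exact: cvg_cst|exact: cvg_harmonic].
  - by [].
  - by have := integrableZl measurableT 2 iGn.
  - move=> n u _ /=; rewrite lee_fin normrM normr_id mulrC ler_wpM2r//.
    by rewrite ger0_norm ?rho_ge0// (le_trans (rho_le _ _))//; have := v1 n; lra.
have /cvgrPdist_le/(_ _ e0)[n _ /(_ n (leqnn n)) /=] := lim.
rewrite sub0r normrN => /(le_trans (ler_norm _)) hn.
exists n.+1%:R; first by rewrite ler1n.
move=> L nL; apply: le_trans hn; have L0 : 0 < L by exact: lt_le_trans nL.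
have iv : L^-1 <= v n by rewrite lef_pV2// posrE ltr0n.
apply: le_Rintegral => //; [by apply: irho; rewrite invr_ge0 ltW|exact: irho|].
by move=> u _; rewrite ler_wpM2l// le_rho.
Unshelve. all: by end_near. Qed.

End tail.

Section local_bound.
Context {R : realType}.
Local Notation mu := (@lebesgue_measure R).
Variables (s : seq nat) (x : nat -> R) (k N : R).
Hypothesis N0 : 0 < N.
Local Notation F := (ffactor s x k N).
Local Notation FF := (Ffactor s x k N).

(** Moving the triangle to centre m multiplies the summand of frequency c by cos (c m) <= 1, and its
    coefficient is nonnegative; so the centred test bounds all translates. With m = t + a/2, the
    translate is at least a/2 on [t, t + a]. *)
Lemma Ffactor_step (a kappa : R) : 0 < a ->
  \int[mu]_u (tri a u * F u) <= kappa ->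
  forall t, FF (t + a) - FF t <= 2 * kappa / a.
Proof.
move=> a0 Hk t.
have ct := tri_continuous a; have it : mu.-integrable setT (EFin \o tri a).
  have := @integrable_tri R a (fun=> 1) (cts_cst _).
  by under eq_fun do rewrite mulr1.
have cF := ffactor_continuous s x k N.
pose K c := \int[mu]_u (tri a u * cos (c * u)).
have tF m : \int[mu]_u (tri a u * F (u + m)) =
    pairsum s x k N (fun c => 1 * cos (c * m) * K c).
  rewrite -integral_ffactor_mul//; last by move=> u; exact: triN.
  by apply: eq_Rintegral => u _; congr (_ * _); apply: eq_pairsum => c; rewrite mul1r.
pose m := t + a / 2.
have le_m : \int[mu]_u (tri a u * F (u + m)) <= kappa.
  apply: le_trans Hk; rewrite tF.
  have := tF 0; under eq_Rintegral do rewrite addr0.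
  move=> ->; apply: (le_pairsum _ _ _ _ N0) => c.
  rewrite !mul1r mulr0 cos0 ler_wpM2r ?cos_le1//.
  exact: tri_cos_ge0.
have cFm : continuous (fun u => F (u + m)).
  by apply: (@cts_comp _ _ F (fun u => u + m)) => //; cts.
have := @le_Rintegral_itvT R (fun u => a / 2 * F (u + m))
  (fun u => tri a u * F (u + m)) (- (a / 2)) (a / 2).
rewrite (@Rintegral_FTC R _ (fun u => a / 2 * FF (u + m))); last 3 first.
- lra.
- by apply: cts_mul => //; exact: cts_cst.
- move=> u; apply: der_eq.
    apply: der_mul; first exact: der_cst.
    apply: (@der_comp R FF (fun u => u + m)); first exact: Ffactor_der.
    by der.
  by rewrite mulr0 !addr0 mulr1.
have -> : a / 2 + m = t + a by rewrite /m; field.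
have -> : - (a / 2) + m = t by rewrite /m; field.
move=> h.
have {h} : a / 2 * FF (t + a) - a / 2 * FF t <= kappa.
  apply: le_trans le_m; apply: h.
  - by apply: cts_mul => //; exact: cts_cst.
  - exact: cts_mul.
  - exact: integrable_tri.
  - by move=> u; rewrite mulr_ge0 ?tri_ge0// (ffactor_ge0 _ _ _ _ N0).
  - move=> u; rewrite -ler_norml => ua; rewrite ler_wpM2r ?(ffactor_ge0 _ _ _ _ N0)//.
    by rewrite tri_in; lra.
by rewrite ler_pdivlMr//; lra.
Qed.

Lemma Ffactor_local (a kappa : R) : 0 < a -> 0 <= kappa ->
  \int[mu]_u (tri a u * F u) <= kappa ->
  forall t l : R, 0 <= l -> FF (t + l) - FF t <= 2 * kappa / a * (a^-1 + 1) * (l + 1).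
Proof.
move=> a0 k0 Hk t l l0.
have step := Ffactor_step _ _ a0 Hk.
set q := 2 * kappa / a in step *.
have q0 : 0 <= q by rewrite divr_ge0 ?mulr_ge0// ltW.
have ind n : FF (t + n%:R * a) - FF t <= n%:R * q.
  elim: n => [|n ih]; first by rewrite !mul0r addr0 subrr.
  have := step (t + n%:R * a).
  have -> : t + n.+1%:R * a = t + n%:R * a + a by rewrite -natr1; ring.
  by rewrite -natr1 mulrDl mul1r; lra.
have la0 : 0 <= l / a by rewrite divr_ge0// ltW.
(* An interval of length l is covered by n + 1 steps of length a, and n + 1 <= l/a + 1 <= (1/a + 1)
   (l + 1). *)
have /andP[n1 n2] := truncn_itv la0.
set n := Num.truncn (l / a) in n1 n2.
have ln : l <= n.+1%:R * a by rewrite -ler_pdivrMr// ltW.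
have := ind n.+1; have := @le_Ffactor R s x k N N0 (t + l) (t + n.+1%:R * a).
rewrite lerD2l => /(_ ln) h1 h2.
apply: (@le_trans _ _ (n.+1%:R * q)); first by lra.
rewrite -mulrA (mulrC n.+1%:R) ler_wpM2l//.
rewrite -natr1 (le_trans (_ : _ <= l / a + 1)) ?lerD2r//.
have -> : (a^-1 + 1) * (l + 1) = l / a + 1 + (a^-1 + l) by ring.
by rewrite lerDl addr_ge0// invr_ge0 ltW.
Qed.

(** Shifting an interval by u changes its mass only through two end pieces of length |u|, each of
    mass at most C (|u| + 1). For large u it is better to bound both masses by C (L + 1). The
    smaller of the two bounds is C L [rho L^-1 u]. *)
Lemma integral_shift_compare (G : R -> R) (C m L : R) :
  continuous G -> mu.-integrable setT (EFin \o G) -> 0 < L ->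
  (forall t l : R, 0 <= l -> FF (t + l) - FF t <= C * (l + 1)) ->
  `|\int[mu]_u (G u * (FF (u + m + L / 2) - FF (u + m - L / 2))) -
    \int[mu]_u G u * (FF (m + L / 2) - FF (m - L / 2))|
  <= C * L * \int[mu]_u (`|G u| * rho L^-1 u).
Proof.
move=> cG iG L0 HC.
have cFF := Ffactor_continuous s x k N.
have nd := @le_Ffactor R s x k N N0.
pose D u := FF (u + m + L / 2) - FF (u + m - L / 2).
have C0 : 0 <= C by have := HC 0 0 (lexx _); rewrite addr0 subrr add0r mulr1.
have cD : continuous D.
  apply: cts_add.
    by apply: (@cts_comp _ _ FF (fun u => u + m + L / 2)) => //; cts.
  apply: cts_opp.
  by apply: (@cts_comp _ _ FF (fun u => u + m - L / 2)) => //; cts.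
have D0 u : 0 <= D u by rewrite subr_ge0; apply: nd; lra.
have D1 u : D u <= C * (L + 1).
  rewrite /D; have -> : u + m + L / 2 = u + m - L / 2 + L by field.
  by apply: HC; exact: ltW.
have inc a b : `|FF (b + a) - FF a| <= C * (`|b| + 1).
  have [b0|b0] := leP 0 b.
    rewrite [b + a]addrC (ger0_norm b0) ger0_norm; first exact: HC.
    by rewrite subr_ge0; apply: nd; lra.
  rewrite distrC (ltr0_norm b0) ger0_norm; last first.
    by rewrite subr_ge0; apply: nd; lra.
  have := HC (b + a) (- b); have -> : b + a + - b = a by ring.
  by apply; lra.
have DD u : `|D u - D 0| <= C * L * rho L^-1 u.
  have -> : C * L * rho L^-1 u = C * Num.min (2 * (`|u| + 1)) (L + 1).
    rewrite /rho -mulrA; congr (_ * _).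
    rewrite minr_pMr ?(ltW L0)//; congr Num.min; field; rewrite gt_eqF//.
  rewrite minr_pMr// le_min; apply/andP; split.
    have -> : D u - D 0 = (FF (u + (m + L / 2)) - FF (m + L / 2)) -
        (FF (u + (m - L / 2)) - FF (m - L / 2)).
      by rewrite /D add0r !addrA; ring.
    rewrite (le_trans (ler_normB _ _))//.
    have := inc (m + L / 2) u; have := inc (m - L / 2) u; lra.
  rewrite ler_norml; apply/andP; split.
    by have := D0 u; have := D1 0; lra.
  by have := D0 0; have := D1 u; lra.
have Db u : `|D u| <= C * (L + 1) by rewrite ger0_norm.
have iGD : mu.-integrable setT (EFin \o (fun u => G u * D u)).
  exact: (integrable_mul_continuous _ _ (C * (L + 1)) iG).
have iGD0 : mu.-integrable setT (EFin \o (fun u => G u * D 0)).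
  apply: (integrable_mul_continuous _ _ (C * (L + 1)) iG); first exact: cts_cst.
  by [].
have -> : \int[mu]_u (G u * D u) - \int[mu]_u G u * (FF (m + L / 2) - FF (m - L / 2))
    = \int[mu]_u (G u * (D u - D 0)).
  have -> : FF (m + L / 2) - FF (m - L / 2) = D 0 by rewrite /D add0r.
  rewrite -RintegralZr// -RintegralB//.
  by apply: eq_Rintegral => u _; rewrite [RHS]mulrBr.
have iGDD : mu.-integrable setT (EFin \o (fun u => G u * (D u - D 0))).
  have := integrableB measurableT iGD iGD0; apply: eq_integrable => // u _ /=.
  by rewrite -EFinB [in RHS]mulrBr.
have v0 : 0 <= L^-1 by rewrite invr_ge0 ltW.
have crho : continuous (rho L^-1).
  by rewrite /rho; cts.
have irho : mu.-integrable setT (EFin \o (fun u => `|G u| * rho L^-1 u)).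
  apply: (integrable_mul_continuous _ _ (1 + L^-1)) => //.
    exact: integrable_norm.
  move=> u; rewrite ger0_norm; first by rewrite /rho ge_min lexx orbT.
  by rewrite /rho le_min !mulr_ge0// ?addr_ge0.
rewrite (le_trans (le_normr_Rintegral _ _))// -RintegralZl//.
apply: le_Rintegral => //; first exact: integrable_norm.
  by have := integrableZl measurableT (C * L) irho.
by move=> u _; rewrite normrM mulrCA ler_wpM2l.
Qed.

End local_bound.

(** * Limits in T *)

Section support.
Context {R : realType}.
Local Notation mu := (@lebesgue_measure R).

Lemma support_in_itv (phi : R -> R) (a Delta : R) : a < Delta ->
  (forall u, a <= `|u| -> phi u = 0) -> support_in phi `]- Delta, Delta[.
Proof.
move=> aD phi0.
have sub : closure [set x | phi x != 0] `<=` `[- a, a].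
  have /closure_id -> : closed (`[- a, a]%classic : set R).
    exact: interval_closed.
  apply: closure_subset => u /= pu; rewrite in_itv/= -ler_norml.
  by rewrite leNgt; apply/negP => /ltW /phi0; exact/eqP.
split.
  apply: subclosed_compact sub; first exact: closed_closure.
  exact: segment_compact.
move=> u /sub; rewrite /= !in_itv/= => /andP[au ua].
by apply/andP; split; lra.
Qed.

Lemma integral_tri_le (b : R) (f : R -> R) : 0 < b -> continuous f ->
  (forall u, 0 <= f u) ->
  \int[mu]_u (tri b u * f u) <= b * \int[mu]_(u in `[- b, b]) f u.
Proof.
move=> b0 cf f0; rewrite -RintegralZl//; last exact: integrable_itv.
have -> : \int[mu]_u (tri b u * f u) = \int[mu]_(u in `[- b, b]) (tri b u * f u).
  rewrite [RHS]Rintegral_mkcond; apply: eq_Rintegral => u _.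
  rewrite /patch; case: ifPn => //.
  rewrite notin_setE/= in_itv/= => /negP; rewrite -ler_norml -ltNge => /ltW ub.
  by rewrite tri_out// mul0r.
apply: le_Rintegral => //.
- by apply: integrable_itv; apply: cts_mul => //; exact: tri_continuous.
- by apply: integrable_itv; apply: cts_mul => //; exact: cts_cst.
- move=> u; rewrite /= in_itv/= -ler_norml => ub; rewrite ler_wpM2r// tri_in//.
  by rewrite gerBl.
Qed.

(** A trapezoid supported strictly inside ]-Delta, Delta[, hence a legitimate factor for a test
    function of the limiting measure. *)
Definition cutoff (Delta eta u : R) : R := Num.min 1 (tri (Delta - eta) u / eta).

Lemma cutoff_continuous Delta eta : continuous (cutoff Delta eta).
Proof. by rewrite /cutoff /tri; cts. Qed.

Lemma cutoff_ge0 Delta eta u : 0 < eta -> 0 <= cutoff Delta eta u.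
Proof. by move=> e0; rewrite le_min ler01 divr_ge0 ?tri_ge0 ?ltW. Qed.

Lemma cutoff_le1 Delta eta u : cutoff Delta eta u <= 1.
Proof. by rewrite ge_min lexx. Qed.

Lemma cutoff_in Delta eta u : 0 < eta -> `|u| <= Delta - 2 * eta ->
  cutoff Delta eta u = 1.
Proof.
move=> e0 ue; rewrite /cutoff tri_in; last by lra.
by apply/min_idPl; rewrite ler_pdivlMr//; lra.
Qed.

Lemma cutoff_out Delta eta u : Delta - eta <= `|u| -> cutoff Delta eta u = 0.
Proof.
by move=> ue; rewrite /cutoff tri_out// mul0r; apply/min_idPr.
Qed.

End support.

Section form_factor_limits.
Context {R : realType}.
Local Notation mu := (@lebesgue_measure R).
Variables (T0 : R) (gamma : R -> nat -> R) (lambda Delta : R)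
  (nu : {finite_measure set (measurableTypeR R) -> \bar R}).
Hypothesis fin : forall T : R, T0 <= T -> finite_set (indices gamma T).
Hypothesis lambda0 : 0 < lambda.
Hypothesis Delta0 : 0 < Delta.
Hypothesis lim : limiting_measure gamma lambda Delta nu.

Definition idx (T : R) : seq nat :=
  finmap.enum_fset (fset_set (indices gamma T)).

Local Notation PS T := (pairsum (idx T) (gamma T) (lambda * ln T)
  (normalization lambda T)).
Local Notation F T := (ffactor (idx T) (gamma T) (lambda * ln T)
  (normalization lambda T)).
Local Notation FF T := (Ffactor (idx T) (gamma T) (lambda * ln T)
  (normalization lambda T)).

Lemma form_factorE al T : T0 <= T -> form_factor gamma lambda al T = F T al.
Proof.
move=> /fin finT; rewrite /form_factor /form_factorC /ffactor /pairsum.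
rewrite !fsbig_finite//=.
have ReM (a : R) (z : R[i]%C) : complex.Re (a%:C%C * z) = a * complex.Re z.
  by case: z => p q /=; rewrite mul0r subr0.
rewrite ReM raddf_sum; congr (_ * _).
apply: eq_bigr => n _; rewrite !fsbig_finite//= raddf_sum.
apply: eq_bigr => m _ /=; rewrite mulr0 subr0 mulrC; congr (_ * cos _).
by ring.
Qed.

Lemma normalization_gt0 T : 1 < T -> 0 < normalization lambda T.
Proof.
move=> T1; rewrite mulr_gt0 ?ln_gt0// divr_gt0 ?mulr_gt0 ?pi_gt0//.
exact: lt_trans T1.
Qed.

Lemma near_large : \forall T \near +oo, T0 <= T /\ 0 < normalization lambda T.
Proof.
near=> T; split; first by near: T; apply: nbhs_pinfty_ge; rewrite num_real.
by apply: normalization_gt0; near: T; apply: nbhs_pinfty_gt; rewrite num_real.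
Unshelve. all: by end_near. Qed.

Lemma limiting_measure_le (phi : R -> R) (a e : R) : continuous phi -> a < Delta ->
  (forall u, a <= `|u| -> phi u = 0) -> 0 < e ->
  \forall T \near +oo, \int[mu]_u (phi u * F T u) <= \int[nu]_u phi u + e.
Proof.
move=> cphi aD phi0 e0.
have /cvgrPdist_le/(_ _ e0) := lim phi cphi (support_in_itv _ _ _ aD phi0).
move=> h; near=> T.
have [T0T _] : T0 <= T /\ 0 < normalization lambda T.
  by near: T; exact: near_large.
have : `|\int[nu]_u phi u - \int[mu]_u (phi u * form_factor gamma lambda u T)| <= e.
  by near: T.
under [X in _ - X]eq_Rintegral do rewrite form_factorE//.
by rewrite distrC => /(le_trans (ler_norm _)); lra.
Unshelve. all: by end_near. Qed.

(** The triangle of half-width Delta / 2 is an allowed test function. Its integral against F is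
    eventually at most its nu-integral plus 1, a bound free of T. *)
Lemma near_Ffactor_local : exists2 C : R, 0 <= C &
  \forall T \near +oo, forall t l : R, 0 <= l -> FF T (t + l) - FF T t <= C * (l + 1).
Proof.
pose a := Delta / 2; have a0 : 0 < a by rewrite divr_gt0.
pose kappa := \int[nu]_u tri a u + 1.
have k0 : 0 <= kappa.
  by rewrite addr_ge0//; apply: Rintegral_ge0 => u _; exact: tri_ge0.
exists (2 * kappa / a * (a^-1 + 1)).
  apply: mulr_ge0; first by apply: divr_ge0; [exact: mulr_ge0|exact: ltW].
  by apply: addr_ge0 => //; rewrite invr_ge0 ltW.
have aD : a < Delta by have := Delta0; rewrite /a; lra.
have h := @limiting_measure_le (tri a) a 1 (tri_continuous a) aD
  (fun u => @tri_out R a u) ltr01.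
near=> T.
have [_ N0] : T0 <= T /\ 0 < normalization lambda T by near: T; exact: near_large.
by apply: (Ffactor_local _ _ _ _ N0) => //; near: T.
Unshelve. all: by end_near. Qed.

(** Every cutoff vanishes at the endpoints and the cutoffs tend to 1 at each interior point, so the
    limit is the integral over the open interval, without any atoms of nu at the endpoints. *)
Lemma cutoff_integral_cvg (G : R -> R) (M : R) : continuous G ->
  (forall u, `|G u| <= M) ->
  \int[nu]_u (G u * cutoff Delta (Delta / n.+1%:R) u) @[n --> \oo] -->
  \int[nu]_(u in `]- Delta, Delta[) G u.
Proof.
move=> cG GM.
pose eta n : R := Delta / n.+1%:R.
have eta0 n : 0 < eta n by rewrite divr_gt0.
have mG (f : R -> R) (D : set R) : measurable D -> continuous f ->
    measurable_fun (D : set (measurableTypeR R)) (EFin \o f).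
  move=> mD cf; apply/measurable_EFinP; apply: measurable_funTS.
  exact: continuous_measurable_fun.
have iM (f : R -> R) : continuous f -> (forall u, `|f u| <= M) ->
    nu.-integrable `]- Delta, Delta[ (EFin \o f).
  move=> cf fM; apply: (@le_integrable _ _ _ nu _ _ _ (EFin \o cst M)) => //.
  - exact: mG.
  - by move=> u _ /=; rewrite lee_fin (le_trans (fM u))// ler_norm.
  - exact: finite_measure_integrable_cst.
have E n : \int[nu]_u (G u * cutoff Delta (eta n) u) =
    \int[nu]_(u in `]- Delta, Delta[) (G u * cutoff Delta (eta n) u).
  rewrite [RHS]Rintegral_mkcond; apply: eq_Rintegral => u _.
  rewrite /patch; case: ifPn => //.
  rewrite notin_setE/= in_itv/= => /negP; rewrite -ltr_norml -leNgt => uD.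
  by rewrite cutoff_out ?mulr0//; have := eta0 n; lra.
under eq_fun do rewrite E.
rewrite /Rintegral; apply: fine_cvg; rewrite fineK; last first.
  by apply: integrable_fin_num => //; exact: iM.
apply: (@dominated_cvg _ _ _ nu _ _ _ _ (EFin \o cst M)) => //.
- by move=> n; apply: mG => //; apply: cts_mul => //; exact: cutoff_continuous.
- move=> u; rewrite /= in_itv/= -ltr_norml => uD.
  apply: cvg_EFin; first by apply: nearW.
  rewrite /= -[X in _ --> X]mulr1; apply: cvgM; first exact: cvg_cst.
  apply/cvgrPdist_le => e e0.
  have eta_cvg : (eta n @[n --> \oo] --> (0 : R)).
    rewrite -[X in _ --> X](mulr0 Delta); apply: cvgM; first exact: cvg_cst.
    exact: cvg_harmonic.
  have d0 : 0 < (Delta - `|u|) / 2 by lra.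
  near=> n; rewrite cutoff_in// ?subrr ?normr0 ?(ltW e0)//.
  have : `|0 - eta n| <= (Delta - `|u|) / 2.
    by near: n; move/cvgrPdist_le: eta_cvg; exact.
  by rewrite sub0r normrN ger0_norm ?(ltW (eta0 n))//; lra.
- exact: finite_measure_integrable_cst.
- move=> n u _ /=; rewrite lee_fin normrM (le_trans _ (GM u))// ler_piMr//.
  by rewrite ger0_norm ?cutoff_ge0// cutoff_le1.
Unshelve. all: by end_near. Qed.

Lemma pairsum_inversion g T : admissible Delta g ->
  PS T (fun c => g (c / (2 * pi))) = \int[mu]_u (cosft g u * F T u).
Proof.
move=> /admissibleP[[cg gN ig] [iG _ _]].
transitivity (\int[mu]_u (cosft g u * PS T (fun c => 1 * cos (c * (u + 0))))).
  rewrite integral_ffactor_mul//; last 2 first.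
    exact: cosft_continuous.
    by move=> u; exact: cosftN.
  apply: eq_pairsum => c; rewrite mulr0 cos0 !mul1r.
  have p0 : 2 * pi != 0 :> R by rewrite mulf_neq0// gt_eqF// pi_gt0.
  rewrite -(cosft_inversion g _ cg gN ig iG); apply: eq_Rintegral => u _.
  by congr (_ * cos (_ * _)); rewrite mulrC divfK.
apply: eq_Rintegral => u _; congr (_ * _); apply: eq_pairsum => c.
by rewrite mul1r addr0.
Qed.

(* Near the endpoints of [-Delta, Delta] the transform is at most a small
   [delta], and the local bound makes the loss in the cutoff negligible. *)
Lemma near_pairsum_le g (e : R) : admissible Delta g -> 0 < e ->
  \forall T \near +oo,
    PS T (fun c => g (c / (2 * pi))) <= Phi Delta nu g + e.
Proof.
move=> adm e0; have /admissibleP[[cg gN ig] [iG Gle _]] := adm.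
have D0 := Delta0.
have cG := cosft_continuous _ ig.
have [C C0 HC] := near_Ffactor_local.
(* K bounds the integral of F against the triangle of half-width Delta + 1, which is at least 1 on
   [-Delta, Delta]. The choice of d makes d K one third of the error; the other thirds go to the
   cutoff and to the limit in T. *)
pose K := (Delta + 1) * (C * (2 * (Delta + 1) + 1)).
have K0 : 0 <= K by rewrite !mulr_ge0// ?addr_ge0 ?mulr_ge0 ?addr_ge0 ?(ltW Delta0).
pose d := e / 3 / (K + 1).
have d0 : 0 < d by rewrite !divr_gt0//; lra.
have dK : d * K <= e / 3.
  by rewrite /d mulrAC ler_pdivrMr ?ler_wpM2l//; lra.
(* The sign condition is strict in |alpha| > Delta, so the value at Delta is compared with one at
   Delta + r/2, where G <= 0; each of the two uses of continuity costs d / 2. *)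
have [r r0 rP] : exists2 r, 0 < r & forall u, Delta - r < `|u| -> cosft g u <= d.
  have d20 : 0 < d / 2 by lra.
  have /cvgrPdist_le/(_ _ d20) := cG Delta.
  rewrite -nbhs_nearE => /nbhs_ballP[r /= r0 Gr]; exists r => // u ru.
  have near_D v : `|v - Delta| < r -> `|cosft g Delta - cosft g v| <= d / 2.
    by move=> vr; apply: Gr; rewrite /ball /= distrC.
  have GD : cosft g Delta <= d / 2.
    have Dr : `|Delta + r / 2 - Delta| < r.
      by rewrite (_ : _ - _ = r / 2) ?gtr0_norm//; [lra|lra|ring].
    have G0 : cosft g (Delta + r / 2) <= 0.
      by apply: Gle; rewrite gtr0_norm; lra.
    by have := le_trans (ler_norm _) (near_D _ Dr); lra.
  have [uD|uD] := ltP Delta `|u|.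
    by rewrite (le_trans (Gle _ uD))// ltW.
  have -> : cosft g u = cosft g `|u|.
    by case: (ler0P u) => _ //; rewrite cosftN.
  have ur : `| `|u| - Delta | < r by rewrite ler0_norm; lra.
  have := near_D _ ur; rewrite distrC => /(le_trans (ler_norm _)); lra.
pose eta n : R := Delta / n.+1%:R.
have eta0 n : 0 < eta n by rewrite divr_gt0.
have e30 : 0 < e / 3 by lra.
have [n [nr nP]] : exists n, eta n < r / 2 /\
    \int[nu]_u (cosft g u * cutoff Delta (eta n) u) <= Phi Delta nu g + e / 3.
  have eta_cvg : (eta n @[n --> \oo] --> (0 : R)).
    rewrite -[X in _ --> X](mulr0 Delta); apply: cvgM; first exact: cvg_cst.
    exact: cvg_harmonic.
  have r20 : 0 < r / 2 by lra.
  have /cvgrPdist_lt/(_ _ r20)[n1 _ h1] := eta_cvg.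
  have /cvgrPdist_le/(_ _ e30)[n2 _ h2] :=
    @cutoff_integral_cvg (cosft g) _ cG (fun u => cosft_bounded g u ig).
  exists (maxn n1 n2); split.
    have := h1 (maxn n1 n2) (leq_maxl _ _).
    by rewrite /= sub0r normrN gtr0_norm.
  have := h2 (maxn n1 n2) (leq_maxr _ _).
  rewrite /= distrC => /(le_trans (ler_norm _)).
  have -> : Phi Delta nu g = \int[nu]_(u in `]- Delta, Delta[) cosft g u.
    by apply: eq_Rintegral => u _; exact: Re_fourier.
  by rewrite /eta; lra.
have etaD : Delta - eta n < Delta by have := eta0 n; lra.
pose phi u := cosft g u * cutoff Delta (eta n) u.
have cphi : continuous phi by apply: cts_mul => //; exact: cutoff_continuous.
have phi0 u : Delta - eta n <= `|u| -> phi u = 0.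
  by move=> ue; rewrite /phi cutoff_out// mulr0.
have hphi := limiting_measure_le _ _ _ cphi etaD phi0 e30.
near=> T.
have [_ N0] : T0 <= T /\ 0 < normalization lambda T by near: T; exact: near_large.
have HCT : forall t l : R, 0 <= l -> FF T (t + l) - FF T t <= C * (l + 1) by near: T.
have hphiT : \int[mu]_u (phi u * F T u) <= \int[nu]_u phi u + e / 3 by near: T.
have cF : continuous (F T) by exact: ffactor_continuous.
have F0 u : 0 <= F T u by exact: ffactor_ge0.
have Fb u := ffactor_bounded (idx T) (gamma T) (lambda * ln T) _ N0 u.
have D10 : 0 < Delta + 1 by lra.
have itri := integrable_tri (Delta + 1) _ cF.
have itrid : mu.-integrable setT (EFin \o (fun u => d * (tri (Delta + 1) u * F T u))).
  by have := integrableZl measurableT d itri.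
have iphi : mu.-integrable setT (EFin \o (fun u => phi u * F T u)).
  apply: (integrable_mul_continuous _ _ _ _ cF Fb).
  apply: (integrable_mul_continuous _ _ 1 iG); first exact: cutoff_continuous.
  by move=> u; rewrite ger0_norm ?cutoff_ge0// cutoff_le1.
have triK : \int[mu]_u (tri (Delta + 1) u * F T u) <= K.
  rewrite (le_trans (integral_tri_le _ _ D10 cF F0))// /K ler_wpM2l ?(ltW D10)//.
  rewrite ffactor_integral; last by lra.
  have := HCT (- (Delta + 1)) (2 * (Delta + 1)).
  have -> : - (Delta + 1) + 2 * (Delta + 1) = Delta + 1 by ring.
  by apply; lra.
rewrite pairsum_inversion//.
(* Pointwise, G <= phi + d times the triangle: phi = G where the cutoff is 1; beyond Delta, phi = 0
   and G <= 0; in the zone between, G <= d because 2 [eta n] < r, and the triangle is at least 1. *)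
apply: (@le_trans _ _ (\int[mu]_u (phi u * F T u + d * (tri (Delta + 1) u * F T u)))).
  apply: le_Rintegral => //.
  - exact: (integrable_mul_continuous _ _ _ iG cF Fb).
  - by have := integrableD measurableT iphi itrid.
  - move=> u _; rewrite (mulrA d) -mulrDl ler_wpM2r// /phi.
    have tri0 := tri_ge0 (Delta + 1) u.
    have c0 := cutoff_ge0 Delta _ u (eta0 n); have c1 := cutoff_le1 Delta (eta n) u.
    have [uD|uD] := leP `|u| (Delta - 2 * eta n).
      by rewrite cutoff_in// mulr1 lerDl mulr_ge0// ltW.
    have [uD1|uD1] := ltP Delta `|u|.
      rewrite cutoff_out; last by have := eta0 n; lra.
      by rewrite mulr0 add0r (le_trans (Gle _ uD1))// mulr_ge0// ltW.
    have Gd : cosft g u <= d by apply: rP; lra.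
    have t1 : 1 <= tri (Delta + 1) u by rewrite tri_in; lra.
    have h1 : cosft g u * (1 - cutoff Delta (eta n) u) <=
              d * (1 - cutoff Delta (eta n) u) by rewrite ler_wpM2r// subr_ge0.
    have h2 : d * (1 - cutoff Delta (eta n) u) <= d * tri (Delta + 1) u.
      by rewrite ler_wpM2l ?(ltW d0)//; lra.
    lra.
rewrite RintegralD// (RintegralZl _ measurableT itri).
have : d * \int[mu]_u (tri (Delta + 1) u * F T u) <= d * K.
  by rewrite ler_wpM2l ?(ltW d0).
rewrite -/(phi _) in nP hphiT *; lra.
Unshelve. all: by end_near. Qed.

End form_factor_limits.

(** * Bounds for the means *)

Section sinc_bounds.
Context {R : realType}.

Lemma sin_norm_le (x : R) : `|sin x| <= `|x|.
Proof.
have pos (y : R) : 0 <= y -> `|sin y| <= y.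
  rewrite le_eqVlt => /predU1P[<-|y0]; first by rewrite sin0 normr0.
  have [c _ ->] : exists2 c, c \in `]0, y[%R & sin y = cos c * y.
    have [c cy e] := @MVT R sin cos 0 y y0
      (fun c _ => is_derive_sin c) (continuous_subspaceT (@continuous_sin R)).
    by exists c => //; move: e; rewrite sin0 !subr0.
  by rewrite normrM (gtr0_norm y0) ler_piMl ?(ltW y0)// cos_max.
have [x0|x0] := leP 0 x; first by rewrite (ger0_norm x0) pos.
rewrite -normrN -sinN (ltr0_norm x0); apply: pos.
by rewrite oppr_ge0 ltW.
Qed.

Lemma sinc_norm_le1 (x : R) : `|sinc x| <= 1.
Proof.
rewrite /sinc; case: eqVneq => [_|x0]; first by rewrite normr1.
by rewrite normrM normfV ler_pdivrMr ?normr_gt0// mul1r sin_norm_le.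
Qed.

Let has_inf_sinc : has_inf (range (@sinc R)).
Proof.
split; first by exists (sinc 0), 0.
exists (-1) => _ [x _ <-].
by have := sinc_norm_le1 x; rewrite ler_norml => /andP[].
Qed.

Lemma s0_le_sinc (x : R) : s0 R <= sinc x.
Proof. by apply: (ge_inf has_inf_sinc.2); exists x. Qed.

Lemma s0_le0 : s0 R <= 0.
Proof.
apply: (le_trans (s0_le_sinc pi)).
by rewrite /sinc gt_eqF ?pi_gt0// sinpi mul0r.
Qed.

Lemma s0_geN1 : -1 <= s0 R.
Proof.
apply: lb_le_inf => [|_ [x _ <-]]; first exact: has_inf_sinc.1.
by have := sinc_norm_le1 x; rewrite ler_norml => /andP[].
Qed.

End sinc_bounds.

Section means.
Context {R : realType}.
Local Notation mu := (@lebesgue_measure R).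
Variables (T0 : R) (gamma : R -> nat -> R) (lambda Delta : R)
  (nu : {finite_measure set (measurableTypeR R) -> \bar R}).
Hypothesis fin : forall T : R, T0 <= T -> finite_set (indices gamma T).
Hypothesis lambda0 : 0 < lambda.
Hypothesis count : counting_asymptotics gamma lambda.
Hypothesis Delta0 : 0 < Delta.
Hypothesis lim : limiting_measure gamma lambda Delta nu.

Local Notation PS T := (pairsum (idx gamma T) (gamma T) (lambda * ln T)
  (normalization lambda T)).
Local Notation F T := (ffactor (idx gamma T) (gamma T) (lambda * ln T)
  (normalization lambda T)).
Local Notation FF T := (Ffactor (idx gamma T) (gamma T) (lambda * ln T)
  (normalization lambda T)).

Lemma near_count (e : R) : 0 < e -> \forall T \near +oo,
  1 - e <= (size (idx gamma T))%:R / normalization lambda T.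
Proof.
move=> e0; have := count; rewrite /counting_asymptotics limf_einfE => h.
have : ((1 - e)%:E < 1%:E)%E by rewrite lte_fin; lra.
rewrite -h => /ereal_sup_gt[_ [V nV <-] eV].
apply: filterS nV => T VT; rewrite -lee_fin ltW//; apply: lt_le_trans eV _.
by apply: ereal_inf_lbound; exists T.
Qed.

(** Only pairs of equal indices are kept, each of weight 1; the remaining pairs, including those of
    repeated ordinates, contribute nonnegative terms. *)
Lemma pairsum_diag T (phi : R -> R) : 0 < normalization lambda T ->
  (forall c, 0 <= phi c) ->
  phi 0 * ((size (idx gamma T))%:R / normalization lambda T) <= PS T phi.
Proof.
move=> N0 phi0; rewrite mulrA mulrC /pairsum ler_wpM2l ?invr_ge0 ?(ltW N0)//.
have -> : phi 0 * (size (idx gamma T))%:R = \sum_(n <- idx gamma T) phi 0.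
  by rewrite big_const_seq count_predT iter_addr_0 mulr_natr.
rewrite !big_seq.
apply: ler_sum => n ns; rewrite (big_rem n)//= subrr mulr0.
rewrite -[leLHS]addr0; apply: lerD.
  by rewrite /weight expr0n addr0 divff// mul1r.
by apply: sumr_ge0 => m _; rewrite mulr_ge0// ltW// weight_gt0.
Qed.

(** L0 is chosen before the centre m, which is possible because the local bound is uniform in
    position; only the range of T depends on m. This is why the upper threshold will not depend on
    b. *)
Lemma near_mean_compare (g : R -> R) (e : R) : admissible Delta g -> 0 < e ->
  exists2 L0 : R, 1 <= L0 & forall L, L0 <= L -> forall m,
  \forall T \near +oo,
    `|L * PS T (fun c => sinc (c * L / 2) * cos (c * m) * g (c / (2 * pi))) -
      g 0 * (FF T (m + L / 2) - FF T (m - L / 2))| <= e * L.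
Proof.
move=> adm e0; have /admissibleP[[cg gN ig] [iG _ _]] := adm.
have cG := cosft_continuous _ ig.
have [C C0 HC] := near_Ffactor_local _ _ _ _ _ fin lambda0 Delta0 lim.
have e10 : 0 < e / (C + 1) by rewrite divr_gt0//; lra.
have [L0 L01 HL] := integral_rho_small _ _ cG iG e10.
exists L0 => // L LL m; have Lgt0 : 0 < L by lra.
near=> T.
have [_ N0] : T0 <= T /\ 0 < normalization lambda T.
  by near: T; exact: near_large.
have HCT : forall t l : R, 0 <= l -> FF T (t + l) - FF T t <= C * (l + 1).
  by near: T.
have := integral_shift_compare _ _ _ _ N0 _ C m L cG iG Lgt0 HCT.
have g0E : \int[mu]_u cosft g u = g 0.
  rewrite -(cosft_inversion g 0 cg gN ig iG); apply: eq_Rintegral => u _.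
  by rewrite mulr0 mul0r cos0 mulr1.
have -> : \int[mu]_u (cosft g u * (FF T (u + m + L / 2) - FF T (u + m - L / 2))) =
    L * PS T (fun c => sinc (c * L / 2) * cos (c * m) * g (c / (2 * pi))).
  under eq_Rintegral do rewrite Ffactor_diff.
  rewrite (integral_ffactor_mul _ _ _ _ _ (fun c => L * sinc (c * L / 2)))//;
    last first.
    by move=> u; exact: cosftN.
  rewrite -pairsumZ; apply: eq_pairsum => c; rewrite -!mulrA; do 3 congr (_ * _).
  have p0 : 2 * pi != 0 :> R by rewrite mulf_neq0// gt_eqF// pi_gt0.
  rewrite -(cosft_inversion g _ cg gN ig iG); apply: eq_Rintegral => u _.
  by congr (_ * cos (_ * _)); rewrite mulrC divfK.
rewrite g0E => /le_trans; apply.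
rewrite mulrAC ler_wpM2r ?(ltW Lgt0)//.
apply: (@le_trans _ _ (C * (e / (C + 1)))); first by rewrite ler_wpM2l ?HL.
by rewrite mulrA ler_pdivrMr; [rewrite mulrC ler_wpM2l ?(ltW e0)|]; lra.
Unshelve. all: by end_near. Qed.

Lemma form_factor_meanE b l T : 0 < l -> T0 <= T ->
  form_factor_mean gamma lambda b l T = (FF T (b + l) - FF T b) / l.
Proof.
move=> l0 TT; rewrite /form_factor_mean mulrC; congr (_ / _).
rewrite -ffactor_integral; last by lra.
by apply: eq_Rintegral => al _; rewrite (form_factorE T0).
Qed.

(** [inf] is a true infimum only for a nonempty set that is bounded below. Here 0 is a lower bound:
    for g >= 0 the pair sum is nonnegative, and for large T it is at most [Phi] plus an arbitrarily
    small error. *)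
Lemma admissible_Cconst (e : R) : 0 < e -> exists g : R -> R,
  [/\ admissible Delta g, 0 < g 0 & Phi Delta nu g / g 0 < Cconst Delta nu + e].
Proof.
move=> e0.
set S := [set Phi Delta nu g / g 0 | g in
  [set g : R -> R | admissible Delta g /\ 0 < g 0]].
have hS : has_inf S.
  split.
    have [g [ag g0]] := admissible_nonempty _ Delta0.
    by exists (Phi Delta nu g / g 0), g.
  exists 0 => _ [g [ag g0] <-]; rewrite divr_ge0 ?(ltW g0)//.
  apply/ler_addgt0Pr => d d0.
  have h := near_pairsum_le _ _ _ _ _ fin lambda0 Delta0 lim g d ag d0.
  have [T [[_ N0] hT]] := filter_ex (filterI (near_large T0 _ lambda0) h).
  apply: le_trans hT; rewrite -[leLHS](mul0r (pairsum (idx gamma T) (gamma T)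
    (lambda * ln T) (normalization lambda T) (fun=> 0))) -pairsumZ.
  apply: (le_pairsum _ _ _ _ N0) => c; rewrite mul0r.
  by have /admissibleP[_ [_ _]] := ag.
have [_ [g [ag g0] <-] h] := inf_adherent e0 hS.
by exists g; split.
Qed.

Lemma near_mean_upper (e : R) : 0 < e -> exists l0 : R, 0 < l0 /\
  forall b l : R, l0 <= l -> \forall T \near +oo,
    form_factor_mean gamma lambda b l T < Cconst Delta nu + e.
Proof.
move=> e0; have e20 : 0 < e / 2 by lra.
have [g [ag g0 gC]] := admissible_Cconst _ e20.
(* After division by g 0, the near-minimiser costs e / 2, and the comparison of means and the limit
   in T cost e / 4 each. *)
have e4 : 0 < e * g 0 / 4 by rewrite divr_gt0// mulr_gt0.
have [L0 L01 HL] := near_mean_compare _ _ ag e4.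
exists L0; split=> [|b l ll]; first by lra.
have l0 : 0 < l by lra.
have hP := near_pairsum_le _ _ _ _ _ fin lambda0 Delta0 lim g _ ag e4.
have hL := HL l ll (b + l / 2).
near=> T.
have [TT N0] : T0 <= T /\ 0 < normalization lambda T.
  by near: T; exact: near_large.
have hPT : PS T (fun c => g (c / (2 * pi))) <= Phi Delta nu g + e * g 0 / 4.
  by near: T.
have : `|l * PS T (fun c => sinc (c * l / 2) * cos (c * (b + l / 2)) *
                              g (c / (2 * pi))) -
      g 0 * (FF T (b + l / 2 + l / 2) - FF T (b + l / 2 - l / 2))| <= e * g 0 / 4 * l.
  by near: T.
have -> : b + l / 2 + l / 2 = b + l by field.
have -> : b + l / 2 - l / 2 = b by ring.
rewrite distrC => /(le_trans (ler_norm _)) h1.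
have h2 : PS T (fun c => sinc (c * l / 2) * cos (c * (b + l / 2)) * g (c / (2 * pi)))
    <= PS T (fun c => g (c / (2 * pi))).
  apply: (le_pairsum _ _ _ _ N0) => c.
  have gc : 0 <= g (c / (2 * pi)) by have /admissibleP[_ [_ _]] := ag.
  rewrite ler_piMl// (le_trans (ler_norm _))// normrM mulr_ile1//.
    exact: sinc_norm_le1.
  exact: cos_max.
have h3 : Phi Delta nu g < (Cconst Delta nu + e / 2) * g 0 by rewrite -ltr_pdivrMr.
rewrite form_factor_meanE// ltr_pdivrMr// -(ltr_pM2l g0).
have h4 : l * PS T (fun c => sinc (c * l / 2) * cos (c * (b + l / 2)) *
                               g (c / (2 * pi)))
    <= l * (Phi Delta nu g + e * g 0 / 4).
  by rewrite ler_wpM2l ?(ltW l0)// (le_trans h2).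
have h5 : l * Phi Delta nu g < l * ((Cconst Delta nu + e / 2) * g 0).
  by rewrite ltr_pM2l.
rewrite mulrBr in h1 *; lra.
Unshelve. all: by end_near. Qed.

Lemma near_mean_lower (e b : R) : 0 < e -> 0 <= b -> exists l0 : R, 0 < l0 /\
  forall l : R, l0 <= l -> \forall T \near +oo,
    1 + s0 R * (Cconst Delta nu - 1) - e < form_factor_mean gamma lambda b l T.
Proof.
move=> e0 b0; pose d := e / 8; have d0 : 0 < d by rewrite divr_gt0.
have s0n := @s0_le0 R; have s01 := @s0_geN1 R.
have [g [ag g0 gC]] := admissible_Cconst _ d0.
have dg0 : 0 < d * g 0 by rewrite mulr_gt0.
have [L0 L01 HL] := near_mean_compare _ _ ag dg0.
have [C C0 HC] := near_Ffactor_local _ _ _ _ _ fin lambda0 Delta0 lim.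
pose X := 1 + s0 R * (Cconst Delta nu - 1) - 6 * d.
(* B is the price of discarding [0, b]: C (b + 1) for its mass and |X| b for replacing the length b
   + l by l. For l >= B / d it is at most l d, which is covered by the gap between X and the mean Y
   - 5 d reached on [0, b + l]. *)
pose B := `|X| * b + C * (b + 1).
have B0 : 0 <= B by rewrite addr_ge0// mulr_ge0// addr_ge0.
exists (L0 + B / d); split=> [|l ll].
  by rewrite (lt_le_trans ltr01)// (le_trans L01)// lerDl divr_ge0// ltW.
have Bd0 : 0 <= B / d by rewrite divr_ge0// ltW.
have l0 : 0 < l by lra.
pose L := 2 * (b + l); have L0L : L0 <= L by rewrite /L; lra.
have hP := near_pairsum_le _ _ _ _ _ fin lambda0 Delta0 lim g _ ag dg0.
have hL := HL L L0L 0.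
have hN := near_count _ d0.
near=> T.
have [TT N0] : T0 <= T /\ 0 < normalization lambda T.
  by near: T; exact: near_large.
have HCT : forall t l : R, 0 <= l -> FF T (t + l) - FF T t <= C * (l + 1).
  by near: T.
have hNT : 1 - d <= (size (idx gamma T))%:R / normalization lambda T by near: T.
have hPT : PS T (fun c => g (c / (2 * pi))) <= Phi Delta nu g + d * g 0.
  by near: T.
have : `|L * PS T (fun c => sinc (c * L / 2) * cos (c * 0) * g (c / (2 * pi))) -
      g 0 * (FF T (0 + L / 2) - FF T (0 - L / 2))| <= d * g 0 * L.
  by near: T.
rewrite add0r sub0r FfactorN opprK (_ : L / 2 = b + l); last by rewrite /L; field.
move/(le_trans (ler_norm _)) => h1.
have gge0 c : 0 <= g c by have /admissibleP[_ [_ _]] := ag.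
set P := PS T (fun c => sinc _ * _ * _) in h1.
(* Since [sinc] - [s0] is nonnegative everywhere and equals 1 - [s0] at 0, the diagonal bound
   applies to it; the [s0] part is then restored with the upper bound for the pair sum of g,
   multiplied by the nonpositive [s0]. *)
have h2 : s0 R * (Phi Delta nu g + d * g 0) + (1 - s0 R) * g 0 * (1 - d) <= P.
  have sg0 : 0 <= (1 - s0 R) * g 0 by rewrite mulr_ge0// ?(ltW g0)//; lra.
  have sd c : 0 <= sinc c - s0 R by rewrite subr_ge0 s0_le_sinc.
  have := @pairsum_diag T (fun c => (sinc (c * L / 2) - s0 R) * g (c / (2 * pi))) N0
    (fun c => mulr_ge0 (sd _) (gge0 _)).
  rewrite /= !mul0r {1}/sinc eqxx => hd.
  have hd' := le_trans (ler_wpM2l sg0 hNT) hd.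
  have PE : PS T (fun c => (sinc (c * L / 2) - s0 R) * g (c / (2 * pi))) =
      P + - s0 R * PS T (fun c => g (c / (2 * pi))).
    rewrite -pairsumZ -pairsumD; apply: eq_pairsum => c.
    by rewrite mulr0 cos0; ring.
  rewrite PE in hd'; have := ler_wnM2l s0n hPT; lra.
have h3 : Phi Delta nu g < (Cconst Delta nu + d) * g 0 by rewrite -ltr_pdivrMr.
pose Y := 1 + s0 R * (Cconst Delta nu - 1).
(* The losses add up to d - 3 [s0] d, at most 4 d because [s0] >= -1. *)
have h4 : g 0 * (Y - 4 * d) <= P.
  apply: le_trans h2; have := ler_wnM2l s0n (ltW h3).
  have : 0 <= (1 + s0 R) * (d * g 0) by rewrite mulr_ge0 ?(ltW dg0)//; lra.
  rewrite /Y; lra.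
have Lpos : 0 <= L by lra.
have h5 : (b + l) * (Y - 5 * d) <= FF T (b + l).
  rewrite -(ler_pM2l g0); have := ler_wpM2l Lpos h4.
  by rewrite /L in h1 *; lra.
have FF0 : FF T 0 = 0.
  by have := FfactorN (idx gamma T) (gamma T) (lambda * ln T)
    (normalization lambda T) 0; rewrite oppr0; lra.
have h6 := HCT 0 b b0; rewrite add0r FF0 subr0 in h6.
have h7 : B <= l * d by rewrite -ler_pdivrMr//; lra.
have h8 : - (`|X| * b) <= X * b.
  by rewrite -mulNr ler_wpM2r// lerNl -normrN ler_norm.
have h9 : 0 <= b * d by rewrite mulr_ge0// ltW.
have h10 : 0 < l * d by rewrite mulr_gt0.
rewrite form_factor_meanE// ltr_pdivlMr//.
have eE : e = 8 * d by rewrite /d; field.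
rewrite eE -/Y; have YE : Y = X + 6 * d by rewrite /X /Y; ring.
rewrite YE in h5 *; rewrite /B in h7.
lra.
Unshelve. all: by end_near. Qed.

End means.

(** Turns an eventual bound into one for every T: the error is 0 wherever the bound already holds,
    hence for all large T, and elsewhere exceeds the defect by 1 to keep the inequality strict. *)
Lemma near_error_term {R : realType} (f : R -> R) (c : R) :
  (\forall T \near +oo, f T < c) ->
  exists r : R -> R, (r T @[T --> +oo] --> 0) /\ forall T, f T < c + r T.
Proof.
move=> h; exists (fun T => if f T < c then 0 else f T - c + 1); split.
  apply: cvg_near_cst; apply: filterS h => T fT.
  by rewrite fT.
move=> T; case: ifPn => [|_]; first by rewrite addr0.
by lra.
Qed.

Theorem theorem1 (R : realType) (T0 : R) (gamma : R -> nat -> R)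
    (lambda Delta : R)
    (nu : {finite_measure set (measurableTypeR R) -> \bar R}) :
  (forall T : R, T0 <= T -> finite_set (indices gamma T)) ->
  0 < lambda -> counting_asymptotics gamma lambda ->
  0 < Delta -> limiting_measure gamma lambda Delta nu ->
  (forall eps : R, 0 < eps ->
     exists l0 : R, 0 < l0 /\
     forall b l : R, 1 <= b -> l0 <= l ->
     exists r : R -> R, (r T @[T --> +oo] --> 0) /\
     forall T : R, T0 <= T ->
       form_factor_mean gamma lambda b l T < Cconst Delta nu + eps + r T) /\
  (forall eps b : R, 0 < eps -> 1 <= b ->
     exists l0 : R, 0 < l0 /\
     forall l : R, l0 <= l ->
     exists r : R -> R, (r T @[T --> +oo] --> 0) /\
     forall T : R, T0 <= T ->
       1 + s0 R * (Cconst Delta nu - 1) - eps + r T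
         < form_factor_mean gamma lambda b l T).
Proof.
move=> fin lambda0 count Delta0 lim; split.
  move=> eps eps0.
  have [l0 [l00 h]] :=
    near_mean_upper _ _ _ _ _ fin lambda0 Delta0 lim _ eps0.
  exists l0; split=> // b l _ ll.
  have [r [r0 hr]] := near_error_term _ _ (h b l ll).
  by exists r; split=> // T _; exact: hr.
move=> eps b eps0 b1; have b0 : 0 <= b by lra.
have [l0 [l00 h]] :=
  near_mean_lower _ _ _ _ _ fin lambda0 count Delta0 lim _ _ eps0 b0.
exists l0; split=> // l ll.
set c := 1 + _ - eps in h *.
have hN : \forall T \near +oo, - form_factor_mean gamma lambda b l T < - c.
  by apply: filterS (h l ll) => T; rewrite ltrN2.
have [r [r0 hr]] := near_error_term _ _ hN.
exists (fun T => - r T); split=> [|T _].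
  by rewrite -oppr0; apply: cvgN.
by have := hr T; lra.
Qed.
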